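(* Let $h$ be a nonnegative definite form in $\mathcal H$ with associated operator $H$, and let $X:\mathbb C^n\to\mathcal H$ be an isometry with $\operatorname{ran}(X)\subset\mathcal Q(h)$. Assume $r=\dim\ker(H)\le n$. Let $\mu_1\le\cdots\le\mu_n$ be the eigenvalues of $\Xi=(H^{1/2}X)^*H^{1/2}X\in\mathbb C^{n\times n}$, and let $\lambda_1\le\lambda_2\le\cdots$ be the eigenvalues of $H$. Put $\sin\Theta_p:=\sin\Theta_p(H^{1/2}\mathcal X,\mathsf{inv}(H^{1/2})\mathcal X)$ with $\mathcal X=\operatorname{ran}(X)$, assume $\sin\Theta_p<1$, and set $$\gamma_r=\min\Big\{\frac{\lambda_p-\mu_k}{\lambda_p+\mu_k}\;:\;k=1,\dots,n;\ p=n+1,\dots,\infty\Big\},\qquad \eta_{\Theta_p}=\frac{\sin\Theta_p}{1-\sin\Theta_p}.$$ If $\gamma_r\ge0$ and $\eta_{\Theta_p}<\min\{\gamma_r,1\}$, then $$|\lambda_i-\mu_i|\le\mu_i\,\sin\Theta_p,\qquad i=1,\dots,n.$$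
   Context: $\mathcal H$ is a Hilbert space. A nonnegative form $h$ is a closed symmetric form with domain $\mathcal Q(h)$ dense in $\mathcal H$ and $h[u]:=h(u,u)\ge0$. Its associated operator $H$ is the nonnegative selfadjoint operator with $\mathcal D(H^{1/2})=\mathcal Q(h)$ and $h(u,v)=(H^{1/2}u,H^{1/2}v)$. The form is nonnegative definite if $\lambda_e(H)>0$, where $\lambda_e(H)$ is the infimum of the essential spectrum of $H$ ($+\infty$ if it is empty). The discrete eigenvalues of $H$, in ascending order and counted with multiplicity, are denoted $0\le\lambda_1\le\lambda_2\le\cdots<\lambda_e(H)$. The inverse image is $\mathsf{inv}(H^{1/2})\mathcal X=\{x\in\mathcal D(H^{1/2}):H^{1/2}x\in\mathcal X\}$. For finite dimensional subspaces with orthogonal projections $P_1,P_2$, the maximal principal angle is $\Theta_p=\arcsin\min\{\|P_1(I-P_2)\|,\|P_2(I-P_1)\|\}$. *)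

(* Defs.v *)
From mathcomp Require Import all_boot all_order all_algebra.
From mathcomp Require Import all_classical all_reals all_analysis.
From mathcomp Require Import complex.
Set Implicit Arguments.
Unset Strict Implicit.
Unset Printing Implicit Defensive.
Import Order.TTheory GRing.Theory Num.Theory Num.Def.
Import numFieldNormedType.Exports.
Local Open Scope classical_set_scope.
Local Open Scope complex_scope.
Local Open Scope ring_scope.

(* A complex Hilbert space is a complete normed module [V] over [R[i]] whose
   norm is induced by a positive definite hermitian form [ip].
   [ip] is linear in its first argument and conjugate linear in its second. *)
Definition induces_norm (R : realType) (V : completeNormedModType R[i])
    (ip : {dot V for conjC}) : Prop :=
  forall x : V, `|x| ^+ 2 = ip x x.

Section Hilbert.
Context {R : realType} {V : completeNormedModType R[i]}.
Variable ip : {dot V for conjC}.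
Local Notation C := R[i].

Definition subspace (D : set V) : Prop :=
  D 0 /\ forall (a : C) (u v : V), D u -> D v -> D (a *: u + v).

(* [f] is a linear isomorphism from C^d onto [M]. *)
Definition has_dim (M : set V) (d : nat) : Prop :=
  exists f : {linear 'cV[C]_d -> V}, injective f /\ range f = M.

(* Partially defined operators; values outside of the domain are irrelevant. *)
Record operator := Operator { dom : set V ; opfun :> V -> V }.

Definition linear_operator (A : operator) : Prop :=
  subspace (dom A) /\
  forall (a : C) (u v : V), dom A u -> dom A v -> A (a *: u + v) = a *: A u + A v.

(* The graph of the adjoint of a densely defined operator. *)
Definition adjoint_graph (A : operator) (v w : V) : Prop :=
  forall u, dom A u -> ip (A u) v = ip u w.

Definition selfadjoint (A : operator) : Prop :=
  [/\ linear_operator A, dense (dom A) &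
      forall v w, adjoint_graph A v w <-> (dom A v /\ A v = w)].

Definition nonneg_selfadjoint (A : operator) : Prop :=
  selfadjoint A /\ forall u, dom A u -> 0 <= ip (A u) u.

Definition opkernel (A : operator) : set V := [set u | dom A u /\ A u = 0].

Definition opeigenspace (A : operator) (z : C) : set V :=
  [set u | dom A u /\ A u = z *: u].

(* [S] is the nonnegative square root of [H]: H = S o S, including domains. *)
Definition is_sqrt_operator (H S : operator) : Prop :=
  [/\ nonneg_selfadjoint S,
      dom H = [set u | dom S u /\ dom S (S u)] &
      forall u, dom H u -> H u = S (S u)].

Definition resolvent_set (A : operator) : set C :=
  [set z | exists T : V -> V,
    [/\ forall v, dom A (T v) /\ A (T v) - z *: T v = v,
        forall u, dom A u -> T (A u - z *: u) = u &
        exists M : C, forall v, `|T v| <= M * `|v| ] ].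

Definition spectrum (A : operator) : set C := ~` resolvent_set A.

(* Isolated points of the spectrum that are eigenvalues of finite multiplicity
   (for selfadjoint operators, where geometric and algebraic multiplicities
   agree). *)
Definition discrete_spectrum (A : operator) : set C :=
  [set z | [/\ spectrum A z,
    exists2 e : C, 0 < e & forall w, spectrum A w -> w != z -> e <= `|w - z| &
    exists2 d : nat, (0 < d)%N & has_dim (opeigenspace A z) d] ].

Definition essential_spectrum (A : operator) : set C :=
  spectrum A `\` discrete_spectrum A.

Definition lambda_ess (A : operator) : \bar R :=
  ereal_inf [set x%:E | x in [set x : R | essential_spectrum A x%:C]].

(* [lam 0 <= lam 1 <= ...] lists the eigenvalues of [A] below [lambda_ess A],
   repeated according to multiplicity; if there are only finitely many of them,
   the remaining terms are equal to [lambda_ess A]. *)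
Definition enumerates_eigenvalues (A : operator) (lam : nat -> \bar R) : Prop :=
  [/\ {homo lam : i j / (i <= j)%N >-> (i <= j)%E},
      forall i, (0 <= lam i <= lambda_ess A)%E &
      forall t : R, (t%:E < lambda_ess A)%E ->
        exists2 m : nat, has_dim (opeigenspace A t%:C) m &
                         ([set i | lam i = t%:E] #= `I_m)%card].

Record qform := QForm { qdom : set V ; qval :> V -> V -> C }.

(* h[u] *)
Definition qnorm (h : qform) (u : V) : R := complex.Re (h u u).

Definition symmetric_form (h : qform) : Prop :=
  [/\ subspace (qdom h),
      forall (a : C) (u v w : V), qdom h u -> qdom h v -> qdom h w ->
        h (a *: u + v) w = a * h u w + h v w &
      forall u v, qdom h u -> qdom h v -> h v u = conjC (h u v)].

Definition closed_form (h : qform) : Prop :=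
  forall (u : nat -> V) (v : V), (forall k, qdom h (u k)) -> u @ \oo --> v ->
    (forall e : R, 0 < e ->
       exists N : nat, forall k l, (N <= k)%N -> (N <= l)%N ->
         qnorm h (u k - u l) < e) ->
    qdom h v /\ qnorm h (u k - v) @[k --> \oo] --> (0 : R).

Definition nonneg_form (h : qform) : Prop :=
  [/\ symmetric_form h, closed_form h, dense (qdom h) &
      forall u, qdom h u -> 0 <= h u u].

(* [H] is the operator associated with [h], and [S] is its square root. *)
Definition associated_operator (h : qform) (H S : operator) : Prop :=
  [/\ nonneg_selfadjoint H, is_sqrt_operator H S, dom S = qdom h &
      forall u v, qdom h u -> qdom h v -> h u v = ip (S u) (S v)].

Definition nonneg_definite (h : qform) (H S : operator) : Prop :=
  [/\ nonneg_form h, associated_operator h H S & (0 < lambda_ess H)%E].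

Definition inv_image (S : operator) (M : set V) : set V :=
  [set x | dom S x /\ M (S x)].

Definition orthoproj (M : set V) (x : V) : V :=
  xget 0 [set y | M y /\ forall m, M m -> ip (x - y) m = 0].

Definition opnorm (T : V -> V) : R :=
  sup [set complex.Re `|T x| | x in [set x : V | `|x| <= 1]].

Definition max_principal_angle (M1 M2 : set V) : R :=
  let P1 := orthoproj M1 in
  let P2 := orthoproj M2 in
  asin (minr (opnorm (fun x => P1 (x - P2 x))) (opnorm (fun x => P2 (x - P1 x)))).

Definition isometry_from_Cn (n : nat) (X : 'cV[C]_n -> V) : Prop :=
  forall c : 'cV[C]_n, `|X c| ^+ 2 = \sum_i `|c i 0| ^+ 2.

(* The adjoint H -> C^n of a linear map C^n -> H. *)
Definition adjoint_map (n : nat) (A : 'cV[C]_n -> V) (v : V) : 'cV[C]_n :=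
  \col_i ip v (A (delta_mx i 0)).

Lemma adjoint_mapP (n : nat) (A : {linear 'cV[C]_n -> V}) (c : 'cV[C]_n) (v : V) :
  ip (A c) v = \sum_i c i 0 * conjC (adjoint_map A v i 0).
Proof.
have cE : c = \sum_i c i 0 *: delta_mx i 0.
  rewrite [LHS]matrix_sum_delta; apply: eq_bigr => i _.
  by rewrite big_ord_recl big_ord0 addr0.
rewrite {1}cE linear_sum linear_sumlz; apply: eq_bigr => i _.
by rewrite linearZ linearZl_LR /= mxE hermC /= expr0 mul1r.
Qed.

(* The matrix of [A^* A] in the canonical basis of C^n. *)
Definition adjoint_mul (n : nat) (A : 'cV[C]_n -> V) : 'M[C]_n :=
  \matrix_(i, j) adjoint_map A (A (delta_mx j 0)) i 0.

(* Eigenvalues in ascending order, counted with algebraic multiplicity. *)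
Definition ordered_eigenvalues (n : nat) (M : 'M[C]_n) (mu : 'I_n -> R) : Prop :=
  {homo mu : i j / (i <= j)%N >-> i <= j} /\
  char_poly M = \prod_i ('X - ((mu i)%:C)%:P).

End Hilbert.

Arguments operator {R} V.
Arguments qform {R} V.

(* (l - m) / (l + m), with its limit 1 at l = +oo. *)
Definition relative_gap (R : realType) (l : \bar R) (m : R) : \bar R :=
  if l is x%:E then ((x - m) / (x + m))%:E else 1%E.

(* The infimum over k = 0..n-1 and p = n, n+1, .., oo, where the index is
   shifted by one and the eigenvalue of index oo is [le], the infimum of the
   essential spectrum. *)
Definition gap (R : realType) (n : nat) (le : \bar R) (lam : nat -> \bar R)
    (mu : 'I_n -> R) : \bar R :=
  ereal_inf [set relative_gap l (mu k) | k in [set: 'I_n] &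
               l in [set lam p | p in [set p | (n <= p)%N]] `|` [set le]].

(* Main.v *)
(* With S = H^(1/2) and h[u] = |S u|^2, a vector y of Q(h) orthogonal to the
   space X satisfies S y _|_ inv(S) X, so |h(x, y)| <= sin Theta_p |S x| |S y| for
   x in X: up to the factors 1 -+ sin Theta_p, h is the orthogonal sum of its
   restrictions to X and to its orthogonal complement.  (The minimum of the two
   gaps in Theta_p is harmless: if |P2 (I - P1)| < 1 then P1 maps inv(S) X onto
   S X, because 0 is at positive distance from the rest of the spectrum, so that
   ran S = (ker S)^perp and dim inv(S) X >= n; the other gap is then not larger.)
   Min-max on X + span y shows, with the gap hypothesis, that h >= mu_n on the
   complement of X, and testing the block form on the span of the first i
   eigenvectors of H gives lambda_i >= (1 - sin Theta_p) mu_i, while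
   lambda_i <= mu_i always holds.

   Below the essential spectrum the min-max principle is proved without spectral
   theorem: the infimum m of h[u] / |u|^2 over the orthogonal complement of some
   eigenvectors is a spectral point by Cauchy-Schwarz, hence isolated, and then
   inverse iteration converges to an eigenvector. *)
Require Import Defs.
From mathcomp Require Import all_boot all_order all_algebra fingroup perm.
From mathcomp Require Import all_classical all_reals all_analysis.
From mathcomp Require Import complex ring lra.
Set Implicit Arguments.
Unset Strict Implicit.
Unset Printing Implicit Defensive.
Import Order.TTheory GRing.Theory Num.Theory Num.Def.
Import numFieldNormedType.Exports.
Local Open Scope classical_set_scope.
Local Open Scope complex_scope.
Local Open Scope ring_scope.

(** * Real inner product and norm, Cauchy-Schwarz inequality *)

Section RealInnerProduct.
Context {R : realType} {V : completeNormedModType R[i]}.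
Context (ip : {dot V for conjC}).
Local Notation C := R[i].

(* Inner product and norms are replaced by real valued versions: the order of
   [R[i]] is partial. *)
Definition real_ip (u v : V) : R := complex.Re (ip u v).
Local Notation rip := real_ip.
Definition sqnorm (u : V) : R := rip u u.
Local Notation sq := sqnorm.
Definition nr (u : V) : R := complex.Re `|u|.

Lemma ripC u v : rip u v = rip v u.
Proof.
rewrite /real_ip hermC /= expr0 mul1r.
by case: (ip v u).
Qed.

Lemma ripDl u v w : rip (u + v) w = rip u w + rip v w.
Proof. by rewrite /real_ip linearDl /= raddfD. Qed.

Lemma ripNl u w : rip (- u) w = - rip u w.
Proof. by rewrite /real_ip linearNl raddfN. Qed.

Lemma ripZl (a : R) u w : rip (a%:C *: u) w = a * rip u w.
Proof.
by rewrite /real_ip linearZl_LR /=; case: (ip u w) => x y /=; rewrite mul0r subr0.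
Qed.

Lemma ripDr u v w : rip w (u + v) = rip w u + rip w v.
Proof. by rewrite !(ripC w) ripDl. Qed.

Lemma ripNr u w : rip w (- u) = - rip w u.
Proof. by rewrite !(ripC w) ripNl. Qed.

Lemma ripZr (a : R) u w : rip w (a%:C *: u) = a * rip w u.
Proof. by rewrite !(ripC w) ripZl. Qed.

Definition ripE := (ripDl, ripDr, ripNl, ripNr, ripZl, ripZr).

Lemma rip0l u : rip 0 u = 0.
Proof. by rewrite /real_ip linear0l. Qed.

Lemma rip0r u : rip u 0 = 0.
Proof. by rewrite ripC rip0l. Qed.

Lemma ip_sq u : ip u u = (sq u)%:C.
Proof.
have := dnorm_ge0 ip u; rewrite /sqnorm /real_ip; case: (ip u u) => x y /=.
by rewrite lecE /= => /andP[/eqP -> _].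
Qed.

Lemma sq_ge0 u : 0 <= sq u.
Proof. by have := dnorm_ge0 ip u; rewrite ip_sq lecR. Qed.

Lemma sq_eq0 u : (sq u == 0) = (u == 0).
Proof. by rewrite -(dnorm_eq0 ip) ip_sq -(inj_eq (@complexI _)). Qed.

Lemma sq_gt0 u : (0 < sq u) = (u != 0).
Proof. by rewrite lt_def sq_ge0 andbT sq_eq0. Qed.

Lemma normE u : `|u| = (nr u)%:C.
Proof.
have := normr_ge0 u; rewrite /nr; case: `|u| => x y /=.
by rewrite lecE /= => /andP[/eqP -> _].
Qed.

Lemma nr_ge0 u : 0 <= nr u.
Proof. by have := normr_ge0 u; rewrite normE lecR. Qed.

Lemma nrD u v : nr (u + v) <= nr u + nr v.
Proof. by have := ler_normD u v; rewrite !normE -raddfD lecR. Qed.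

Lemma nrN u : nr (- u) = nr u.
Proof. by rewrite /nr normrN. Qed.

Lemma nrZ (a : R) u : nr (a%:C *: u) = `|a| * nr u.
Proof.
apply: (@complexI R); rewrite -normE normrZ normE rmorphM /=; congr (_ * _).
by rewrite normc_def /= expr0n addr0 sqrtr_sqr.
Qed.

Lemma nr0 : nr 0 = 0.
Proof. by rewrite /nr normr0. Qed.

Lemma nr_eq0 u : (nr u == 0) = (u == 0).
Proof. by rewrite -(normr_eq0 u) normE -(inj_eq (@complexI _)). Qed.

Context (Hip : induces_norm ip).

Lemma nr_sq u : nr u ^+ 2 = sq u.
Proof.
by apply: (@complexI R); rewrite rmorphXn /= -normE Hip ip_sq.
Qed.

(** The discriminant criterion behind each use of Cauchy-Schwarz below. The leading coefficient may
    vanish, since some of the forms are only semidefinite. *)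
Lemma sqr_le_of_quadratic_ge0 (a b c : R) :
  (forall t, 0 <= a * t ^+ 2 + 2 * b * t + c) -> b ^+ 2 <= a * c.
Proof.
move=> h.
have c0 : 0 <= c by have := h 0; rewrite expr0n /= !mulr0 !add0r.
have a0 : 0 <= a.
  rewrite leNgt; apply/negP => an.
  have [t0 ht] : exists t, a * t ^+ 2 + 2 * b * t + c < 0.
    (* This point is at least 1 and satisfies [a * t + 2 * b <= - (c + 1)], so the value there is at
       most [c - (c + 1) * t <= -1]. *)
    exists ((c + 1 + `|b| * 2) / (- a) + 1).
    set t := _ + 1.
    have t1 : 1 <= t.
      by rewrite lerDr divr_ge0 ?oppr_ge0 ?(ltW an)// addr_ge0 ?addr_ge0// mulr_ge0.
    have at' : a * t <= - (c + 1 + `|b| * 2).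
      rewrite /t mulrDr mulr1 invrN mulrN mulrN.
      by rewrite mulrCA divff ?lt_eqF// mulr1 gerDl ltW.
    have bb : b <= `|b| by exact: ler_norm.
    have : t * (a * t + 2 * b) <= t * (- (c+1)) by rewrite ler_wpM2l //; lra.
    nra.
  by have := h t0; lra.
have [a00|a00] := eqVneq a 0.
  have [b00|b00] := eqVneq b 0; first by rewrite b00 a00 expr0n /= mul0r.
  have := h (- (c + 1) / (2 * b)).
  rewrite a00 mul0r add0r mulrCA divff ?mulf_neq0 ?pnatr_eq0//; lra.
have ap : 0 < a by rewrite lt_def a00.
have := h (- b / a).
have -> : a * (- b / a) ^+ 2 + 2 * b * (- b / a) + c = (a * c - b ^+ 2) / a.
  by field.
by rewrite pmulr_lge0 ?invr_gt0// subr_ge0.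
Qed.

Lemma rip_CS u v : rip u v <= nr u * nr v.
Proof.
have : rip u v ^+ 2 <= sq u * sq v.
  apply: sqr_le_of_quadratic_ge0 => t.
  have := sq_ge0 (t%:C *: u + v); rewrite /sqnorm !ripE (ripC v u); nra.
rewrite -!nr_sq -exprMn => h.
have p : 0 <= nr u * nr v by rewrite mulr_ge0 ?nr_ge0.
by case: (lerP (rip u v) 0) => [h0|/ltW h0]; [lra|rewrite -(@ler_pXn2r _ 2)].
Qed.

(** [rip u ('i *: v)] is the imaginary part of [ip u v]. *)
Lemma ip_rip0 u v : rip u v = 0 -> rip u ('i *: v) = 0 -> ip u v = 0.
Proof.
rewrite /real_ip linearZr_LR /=; case: (ip u v) => x y /= -> .
by rewrite mulr0 sub0r mulN1r opprK => ->.
Qed.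

Lemma ip_ripZ u v (a : C) : ip u v = 0 -> rip u (a *: v) = 0.
Proof. by rewrite /real_ip linearZr_LR /= => ->; rewrite mulr0. Qed.

End RealInnerProduct.

(** * Neumann series *)

Section Neumann.
Context {R : realType} {V : completeNormedModType R[i]}.
Context (ip : {dot V for conjC}).
Context (Hip : induces_norm ip).
Local Notation C := R[i].
Local Notation rip := (real_ip ip).
Local Notation sq := (sqnorm ip).

(** Letting [n] tend to infinity keeps the explicit rate [b m] for the limit. *)
Lemma complete_seq (u : nat -> V) (b : nat -> R) :
  (forall m n, (m <= n)%N -> nr (u n - u m) <= b m) ->
  (forall e : R, 0 < e -> exists m, b m < e) ->
  exists l, forall m, nr (l - u m) <= b m.
Proof.
move=> hub hb.
have cu : cauchy (u @ \oo).
  apply: cauchy_exP => e e0.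
  have er : e = (complex.Re e)%:C.
    by move: e0; case: e => x y; rewrite ltcE /= => /andP[/eqP -> _].
  rewrite er ltcR in e0 *.
  have [m hm] := hb _ e0.
  exists (u m); exists m => // n /= mn.
  rewrite -ball_normE /ball_ /= distrC normE ltcR.
  exact: le_lt_trans (hub _ _ mn) hm.
have /cauchy_cvgP/cvg_ex[l /cvgrPdist_lt hl] := cu.
exists l => m; apply/ler_addgt0Pr => e e0.
have /hl[N _ hN] : 0 < e%:C :> C by rewrite ltcR.
have /hN : (N <= maxn N m)%N by rewrite leq_maxl.
rewrite /= normE ltcR => h1.
have h2 := hub _ _ (leq_maxr N m).
have -> : l - u m = (l - u (maxn N m)) + (u (maxn N m) - u m).
  by rewrite addrA subrK.
by apply: le_trans (nrD _ _) _; rewrite addrC lerD // ltW.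
Qed.

Lemma geometric_small (B q e : R) : 0 <= q < 1 -> 0 < e -> exists m, B * q ^+ m < e.
Proof.
move=> /andP[q0 q1] e0.
have : B * q ^+ m @[m --> \oo] --> B * 0.
  by apply: cvgMr; apply: cvg_expr; rewrite ger0_norm.
rewrite mulr0 => /cvgrPdist_lt /(_ _ e0)[N _ /(_ N (leqnn N))] /=.
by rewrite sub0r normrN => /(le_lt_trans (ler_norm _)) h; exists N.
Qed.

Lemma geometric_le0 (B q x : R) : 0 <= q < 1 ->
  (forall m, x <= B * q ^+ m) -> x <= 0.
Proof.
move=> hq h; rewrite leNgt; apply/negP => /(geometric_small B hq)[m hm].
by have := h m; lra.
Qed.

(** The solution is the sum of the iterates of [T] at [y]. Decay is asked along this orbit only,
    because in the applications the contraction is available only on part of the space; the global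
    bound [M] serves to pass to the limit under [T]. The last clause carries orthogonality from the
    terms to the sum. *)
Lemma neumann (T : V -> V) (M q : R) (y : V) :
  {morph T : u v / u + v} -> (forall v, nr (T v) <= M * nr v) -> 0 <= q < 1 ->
  (forall j, nr (iter j.+1 T y) <= q * nr (iter j T y)) ->
  exists z, [/\ z - T z = y, nr z <= nr y / (1 - q) &
    forall e, (forall j, rip (iter j T y) e = 0) -> rip z e = 0].
Proof.
move=> TD hM /[dup] hq /andP[q0 q1] hy.
have T0 : T 0 = 0.
  by apply: (@addrI _ (T 0)); rewrite -TD !addr0.
have TN u : T (- u) = - T u.
  by apply: (@addrI _ (T u)); rewrite -TD !subrr T0.
pose u m := \sum_(j < m) iter j T y.
pose B := nr y / (1 - q).
have q1' : 0 < 1 - q by rewrite subr_gt0.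
have B0 : 0 <= B by rewrite divr_ge0 ?nr_ge0 // ltW.
have yB : nr y = B * (1 - q) by rewrite /B divfK // gt_eqF.
have hj j : nr (iter j T y) <= q ^+ j * nr y.
  elim: j => [|j IH]; first by rewrite expr0 mul1r.
  by apply: le_trans (hy j) _; rewrite exprS -mulrA ler_wpM2l.
have hu m n : (m <= n)%N -> nr (u n - u m) <= B * q ^+ m.
  move=> mn; have : nr (u n - u m) <= B * q ^+ m - B * q ^+ n.
    elim: n mn => [|n IH]; first by rewrite leqn0 => /eqP ->; rewrite !subrr nr0.
    rewrite leq_eqVlt => /orP[/eqP ->|]; first by rewrite !subrr nr0.
    rewrite ltnS => /IH h.
    have -> : u n.+1 - u m = (u n - u m) + iter n T y.
      by rewrite /u big_ord_recr /= addrAC.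
    apply: le_trans (nrD _ _) _; have := hj n; rewrite yB exprS; lra.
  by move=> h; apply: le_trans h _; rewrite gerBl mulr_ge0 // exprn_ge0.
have [z hz] := complete_seq hu (fun e => geometric_small B hq).
exists z; split.
- have M0 : 0 <= `|M| by [].
  have hM' v : nr (T v) <= `|M| * nr v.
    by apply: le_trans (hM v) _; rewrite ler_wpM2r ?nr_ge0 ?ler_norm.
  apply/eqP; rewrite -subr_eq0 -nr_eq0 eq_le nr_ge0 andbT.
  apply: (@geometric_le0 (B + `|M| * B) q) => // m.
  (* The partial sums satisfy [u m.+1 = y + T (u m)], so the residual is controlled by their
     distance to [z]. *)
  have -> : z - T z - y = (z - u m.+1) - T (z - u m).
    have -> : u m.+1 = y + T (u m).
      rewrite /u big_ord_recl /=; congr (_ + _).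
      by rewrite (big_morph T TD T0); apply: eq_bigr.
    by rewrite TD TN opprB addrA opprD !addrA subrK addrAC.
  apply: le_trans (nrD _ _) _; rewrite nrN mulrDl; apply: lerD.
    apply: le_trans (hz _) _; rewrite ler_wpM2l // exprS ler_piMl ?exprn_ge0 //.
    exact: ltW.
  by apply: le_trans (hM' _) _; rewrite -mulrA ler_wpM2l.
- by have := hz 0%N; rewrite /u big_ord0 subr0 expr0 mulr1.
- move=> e he.
  have h0 m : rip (u m) e = 0.
    rewrite /u; elim: m => [|m IH]; first by rewrite big_ord0 rip0l.
    by rewrite big_ord_recr /= ripDl IH he addr0.
  have key w : (forall m, rip (u m) w = 0) -> rip z w <= 0.
    move=> hw; apply: (@geometric_le0 (B * nr w) q) => // m.
    have -> : rip z w = rip (z - u m) w by rewrite !ripE hw oppr0 addr0.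
    apply: le_trans (rip_CS Hip _ _) _.
    by rewrite mulrAC ler_wpM2r ?nr_ge0.
  apply/eqP; rewrite eq_le key //= -oppr_le0 -ripNr key // => m.
  by rewrite ripNr h0 oppr0.
Qed.

End Neumann.

(** * Rayleigh quotients, the square root of an operator, resolvents at real points *)

Section Operators.
Context {R : realType} {V : completeNormedModType R[i]}.
Context (ip : {dot V for conjC}).
Context (Hip : induces_norm ip).
Local Notation C := R[i].
Local Notation rip := (real_ip ip).
Local Notation sq := (sqnorm ip).

Lemma rayleigh_inf (D : set V) (f : V -> R) (u0 : V) :
  (forall u, 0 <= f u) -> D u0 -> u0 != 0 ->
  exists m, [/\ 0 <= m, forall u, D u -> m * sq u <= f u &
    forall e, 0 < e -> exists2 u, D u & f u < (m + e) * sq u].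
Proof.
move=> f0 Du0 u00.
pose A := [set f u / sq u | u in [set u | D u /\ u != 0]].
have A0 : A !=set0 by exists (f u0 / sq u0), u0.
have Al : lbound A 0 by move=> _ [u _ <-]; rewrite divr_ge0 ?sq_ge0.
have hA : has_inf A by split => //; exists 0.
exists (inf A); split.
- exact: lb_le_inf.
- move=> u Du; have [->|u0'] := eqVneq u 0; first by rewrite /sq rip0l mulr0.
  rewrite -ler_pdivlMr ?sq_gt0 //; apply: ge_inf; first by exists 0.
  by exists u.
- move=> e e0; have [_ [u [Du u1] <-] h] := inf_adherent e0 hA.
  by exists u => //; rewrite -ltr_pdivrMr ?sq_gt0.
Qed.

(* Cauchy-Schwarz for the nonnegative form [f - m |.|^2] tested on [u] and on
   the solution [v] of the equation of this form with right hand side [u]. *)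
Lemma rayleigh_inf_not_invertible (D : set V) (f : V -> R) (m M : R) :
  0 < M ->
  (forall e, 0 < e -> exists2 u, D u & f u < (m + e) * sq u) ->
  ~ (forall u, D u -> exists2 v, nr v <= M * nr u &
      forall t : R, 0 <= rip u v * t ^+ 2 + 2 * sq u * t + (f u - m * sq u)).
Proof.
move=> M0 hnear hinv.
(* Cauchy-Schwarz will give [sq u <= M * (f u - m * sq u)]; this accuracy makes the right-hand side
   smaller than [sq u / 2]. *)
have [|u Du hu] := hnear (1 / (2 * M)); first by rewrite divr_gt0 ?mulr_gt0.
have [v hv hq] := hinv u Du.
have h1 := sqr_le_of_quadratic_ge0 hq.
have c0 : 0 <= f u - m * sq u by have := hq 0; rewrite expr0n /= !mulr0 !add0r.
have h2 : rip u v <= M * sq u.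
  apply: le_trans (rip_CS Hip _ _) _.
  by rewrite -nr_sq // expr2 mulrCA ler_wpM2l ?nr_ge0.
have s0 : 0 < sq u.
  rewrite lt_def sq_ge0 andbT; apply/eqP => s0; rewrite s0 !mulr0 in hu c0.
  by lra.
have h3 : sq u * sq u <= sq u * (M * (f u - m * sq u)).
  rewrite -expr2; apply: le_trans h1 _.
  by rewrite mulrA (mulrC (sq u) M) ler_wpM2r.
rewrite ler_pM2l // in h3.
have h4 : M * (f u - m * sq u) < M * (1 / (2 * M) * sq u).
  by rewrite ltr_pM2l //; lra.
have h5 : M * (1 / (2 * M) * sq u) = sq u / 2 by field; rewrite gt_eqF.
by lra.
Qed.

Context (H S : operator V) (HS : is_sqrt_operator ip H S).

Lemma domS_lin a u v : dom S u -> dom S v -> dom S (a *: u + v).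
Proof. by case: HS => -[[[[_ h] _] _ _] _] _ _; exact: h. Qed.

Lemma opS_lin a u v : dom S u -> dom S v -> S (a *: u + v) = a *: S u + S v.
Proof. by case: HS => -[[[_ h] _ _] _] _ _; exact: h. Qed.

Lemma domS0 : dom S 0.
Proof. by case: HS => -[[[[h _] _] _ _] _] _ _. Qed.

Lemma opS0 : S 0 = 0.
Proof.
have := opS_lin 1 domS0 domS0; rewrite !scale1r addr0 => h.
by apply: (@addrI _ (S 0)); rewrite addr0.
Qed.

Lemma domSZ a u : dom S u -> dom S (a *: u).
Proof. by move=> h; have := domS_lin a h domS0; rewrite addr0. Qed.

Lemma opSZ a u : dom S u -> S (a *: u) = a *: S u.
Proof. by move=> h; have := opS_lin a h domS0; rewrite opS0 !addr0. Qed.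

Lemma domSD u v : dom S u -> dom S v -> dom S (u + v).
Proof. by move=> hu hv; have := domS_lin 1 hu hv; rewrite scale1r. Qed.

Lemma opSD u v : dom S u -> dom S v -> S (u + v) = S u + S v.
Proof. by move=> hu hv; have := opS_lin 1 hu hv; rewrite !scale1r. Qed.

Lemma domSN u : dom S u -> dom S (- u).
Proof. by move=> h; rewrite -scaleN1r; exact: domSZ. Qed.

Lemma opSN u : dom S u -> S (- u) = - S u.
Proof. by move=> h; rewrite -scaleN1r opSZ // scaleN1r. Qed.

Lemma S_sym_ip u v : dom S u -> dom S v -> ip (S u) v = ip u (S v).
Proof.
move=> hu hv; case: HS => -[[_ _ h] _] _ _.
by apply: ((h v (S v)).2 _) => //; split.
Qed.

Lemma domHP u : dom H u <-> dom S u /\ dom S (S u).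
Proof. by case: HS => _ -> _. Qed.

Lemma opHE u : dom H u -> H u = S (S u).
Proof. by case: HS => _ _; apply. Qed.

Lemma domHS u : dom H u -> dom S u.
Proof. by case/domHP. Qed.

Lemma domH_lin a u v : dom H u -> dom H v -> dom H (a *: u + v).
Proof.
move=> /domHP[u1 u2] /domHP[v1 v2]; apply/domHP.
by rewrite opS_lin //; split; exact: domS_lin.
Qed.

Lemma opH_lin a u v : dom H u -> dom H v -> H (a *: u + v) = a *: H u + H v.
Proof.
move=> hu hv; rewrite !opHE //; last exact: domH_lin.
by move: hu hv => /domHP[u1 u2] /domHP[v1 v2]; rewrite !opS_lin.
Qed.

Lemma domH0 : dom H 0.
Proof. by apply/domHP; rewrite opS0; split; exact: domS0. Qed.

Lemma opH0 : H 0 = 0.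
Proof. by rewrite opHE ?opS0 //; exact: domH0. Qed.

Lemma domHZ a u : dom H u -> dom H (a *: u).
Proof. by move=> h; have := domH_lin a h domH0; rewrite addr0. Qed.

Lemma opHZ a u : dom H u -> H (a *: u) = a *: H u.
Proof. by move=> h; have := opH_lin a h domH0; rewrite opH0 !addr0. Qed.

Lemma domHD u v : dom H u -> dom H v -> dom H (u + v).
Proof. by move=> hu hv; have := domH_lin 1 hu hv; rewrite scale1r. Qed.

Lemma opHD u v : dom H u -> dom H v -> H (u + v) = H u + H v.
Proof. by move=> hu hv; have := opH_lin 1 hu hv; rewrite !scale1r. Qed.

Lemma H_form_ip u v : dom H u -> dom S v -> ip (H u) v = ip (S u) (S v).
Proof.
by move=> hu hv; rewrite opHE // S_sym_ip //; case/domHP: hu.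
Qed.

Lemma H_form u v : dom H u -> dom S v -> rip (H u) v = rip (S u) (S v).
Proof. by move=> hu hv; rewrite /real_ip H_form_ip. Qed.

Lemma H_sym_ip u v : dom H u -> dom H v -> ip (H u) v = ip u (H v).
Proof.
move=> hu hv; rewrite (opHE hv) H_form_ip //; last exact: domHS.
by case/domHP: hu => hu _; case/domHP: hv => _ hv; rewrite S_sym_ip.
Qed.

Lemma H_sym u v : dom H u -> dom H v -> rip (H u) v = rip u (H v).
Proof. by move=> hu hv; rewrite /real_ip H_sym_ip. Qed.

Record resolvent_at (z : R) (T : V -> V) (M : R) : Prop := ResolventAt {
  res_gt0 : 0 < M;
  res_dom : forall v, dom H (T v);
  res_eq : forall v, H (T v) = v + z%:C *: T v;
  res_inv : forall u, dom H u -> T (H u - z%:C *: u) = u;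
  res_bound : forall v, nr (T v) <= M * nr v;
  res_add : {morph T : u v / u + v};
  res_scale : forall a u, T (a *: u) = a *: T u }.

(** Linearity of [T] comes from its being a two-sided inverse of the linear map [H - z]; a real
    positive bound replaces the complex one. *)
Lemma resolventP z : resolvent_set H z%:C -> exists T M, resolvent_at z T M.
Proof.
move=> [T [h1 h2 [M hM]]].
have dT v : dom H (T v) by case: (h1 v).
have eT v : H (T v) = v + z%:C *: T v.
  by apply/eqP; rewrite -subr_eq; apply/eqP; case: (h1 v).
have TL a u v : T (a *: u + v) = a *: T u + T v.
  rewrite -[RHS]h2; last by apply: domH_lin.
  congr T; rewrite opH_lin // !eT !scalerDr !scalerA [z%:C * a]mulrC.
  by rewrite addrACA addrK.
have T0 : T 0 = 0.
  have := TL 1 0 0; rewrite !scale1r addr0 => h.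
  by apply: (@addrI _ (T 0)); rewrite addr0.
have M0 : 0 < `|complex.Re M| + 1 by rewrite ltr_wpDl.
exists T, (`|complex.Re M| + 1); split => //.
- move=> v; have := hM v; rewrite !normE; case: M {hM M0} => x y /=.
  rewrite lecE /= => /andP[_]; rewrite mulr0 subr0 => h.
  apply: le_trans h _; rewrite ler_wpM2r ?nr_ge0 //.
  by apply: le_trans (ler_norm _) _; rewrite lerDl.
- by move=> u v; have := TL 1 u v; rewrite !scale1r.
- by move=> a u; have := TL a u 0; rewrite T0 !addr0.
Qed.

End Operators.

(** * Bottom of the spectrum on the complement of a set of eigenvectors *)

Section SpectralGap.
Context {R : realType} {V : completeNormedModType R[i]}.
Context (ip : {dot V for conjC}).
Context (Hip : induces_norm ip).
Context (H S : operator V) (HS : is_sqrt_operator ip H S).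
Local Notation C := R[i].
Local Notation rip := (real_ip ip).
Local Notation sq := (sqnorm ip).

Definition eigenset (E : set V) : Prop :=
  forall e, E e -> exists l : R, dom H e /\ H e = l%:C *: e.

(** Only real parts are tested; for [E] stable under multiplication by ['i] this is complex
    orthogonality. *)
Definition orthogonal_to (E : set V) (u : V) : Prop := forall e, E e -> rip u e = 0.
Local Notation perp := orthogonal_to.

Lemma perpD E u v : perp E u -> perp E v -> perp E (u + v).
Proof. by move=> hu hv e Ee; rewrite ripDl hu // hv // addr0. Qed.

Lemma perpZ E (a : R) u : perp E u -> perp E (a%:C *: u).
Proof. by move=> hu e Ee; rewrite ripZl hu // mulr0. Qed.

Lemma perpN E u : perp E u -> perp E (- u).
Proof. by move=> hu e Ee; rewrite ripNl hu // oppr0. Qed.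

(** Symmetry of [H] turns [rip v e = 0] into [(l - z) * rip (T v) e = 0]; if [l = z], injectivity of
    [H - z] gives [e = 0]. Hence resolvents act inside the complement of [E]. *)
Lemma res_perp z T M E v : resolvent_at H z T M -> eigenset E ->
  perp E v -> perp E (T v).
Proof.
move=> hT hE hv e Ee; have [l [de He]] := hE e Ee.
have [lz|lz] := eqVneq l z.
  have e0 : e = 0.
    rewrite -(res_inv hT de) He lz subrr.
    by have := res_scale hT 0 0; rewrite !scale0r.
  by rewrite e0 rip0r.
have := H_sym HS (res_dom hT v) de.
rewrite (res_eq hT) He !ripE hv // add0r => /eqP.
rewrite eq_sym -subr_eq0 -mulrBl mulf_eq0 subr_eq0 (negPf lz) /=.
by move/eqP.
Qed.

(** For the form [a[u] = |S u|^2 - m |u|^2], nonnegative on the complement of [E], a resolvent [T]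
    at [m] would give [v = T u] with [a(u, v) = |u|^2] and [a(v, v) = (u, v)]; near-minimizers [u]
    exclude this. *)
Lemma inf_not_resolvent E m : eigenset E ->
  (forall u, dom S u -> perp E u -> m * sq u <= sq (S u)) ->
  (forall e : R, 0 < e ->
    exists2 u, dom S u /\ perp E u & sq (S u) < (m + e) * sq u) ->
  ~ resolvent_set H m%:C.
Proof.
move=> hE hm hnear /(resolventP HS)[T [M hT]].
pose D := [set u | dom S u /\ perp E u].
apply: (@rayleigh_inf_not_invertible _ _ _ Hip D (fun u => sq (S u)) m M) => //.
  exact: res_gt0 hT.
move=> u [du pu]; exists (T u); first exact: res_bound hT u.
move=> t; set v := T u.
have dv : dom H v by exact: res_dom hT u.
have dv' : dom S v := domHS HS dv.
have h1 : rip (S u) (S v) = sq u + m * rip u v.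
  rewrite ripC -(H_form HS) // (res_eq hT) !ripE; congr (_ + _ * _).
  exact: ripC.
have h2 : sq (S v) = rip u v + m * sq v.
  by rewrite /sqnorm -(H_form HS) // {1}/v (res_eq hT) !ripE.
have := hm (u + t%:C *: v) (domSD HS du (domSZ HS _ dv')).
rewrite (opSD HS) ?(opSZ HS) //; last exact: (domSZ HS).
have pv : perp E (u + t%:C *: v) by apply/perpD/perpZ/(res_perp hT).
move/(_ pv); rewrite /sqnorm !ripE in h2 *.
rewrite (ripC ip (S v)) (ripC ip v u) h1 h2 /sqnorm; lra.
Qed.

(* If [(m, m + 2 d)] is free of spectrum then [(H - m) (H - m - 2 d) >= 0];
   otherwise the infimum [k ^ 2 < d ^ 2] of [|(H - m - d) u|^2 / |u|^2] would
   make one of [H - m - d - k] and [H - m - d + k] singular. *)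
Lemma spectral_gap_ineq E (m d : R) u : eigenset E -> 0 < d ->
  (forall z : R, m < z < m + 2 * d -> resolvent_set H z%:C) ->
  dom H u -> perp E u ->
  2 * d * (sq (S u) - m * sq u) <= sq (H u - m%:C *: u).
Proof.
move=> hE d0 hres du pu; rewrite leNgt; apply/negP => hlt.
pose c := m + d; pose f v := sq (H v - c%:C *: v).
have hSu : sq (S u) = rip (H u) u.
  by rewrite /sqnorm -(H_form HS) //; exact: (domHS HS du).
(* Completing the square: [|(H - m) u|^2 - 2 d ((H - m) u, u) = |(H - c) u|^2 - d^2 |u|^2]. *)
have hf : f u < d ^+ 2 * sq u.
  move: hlt; rewrite hSu /f /c /sqnorm rmorphD scalerDl !ripE (ripC ip u (H u)).
  by nra.
have u0 : u != 0.
  rewrite -(sq_eq0 ip); apply/eqP => s0; rewrite s0 mulr0 in hf.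
  by move: (sq_ge0 ip (H u - c%:C *: u)); rewrite leNgt hf.
pose D := [set v | dom H v /\ perp E v].
have f0 v : 0 <= f v by exact: sq_ge0.
have [m2 [m20 hm2 hnear]] := rayleigh_inf ip (D := D) f0 (conj du pu) u0.
have m2d : m2 < d ^+ 2.
  have := hm2 u (conj du pu); rewrite -(sq_gt0 ip) in u0.
  by move=> /le_lt_trans/(_ hf); rewrite ltr_pM2r.
pose k := Num.sqrt m2.
have k0 : 0 <= k by exact: sqrtr_ge0.
have kk : m2 = k ^+ 2 by rewrite sqr_sqrtr.
have kd : k < d by rewrite kk in m2d; rewrite ltNge; apply/negP => h; nra.
have [|T1 [M1 hT1]] := resolventP HS (hres (c + k) _).
  by rewrite /c; apply/andP; split; lra.
have [|T2 [M2 hT2]] := resolventP HS (hres (c - k) _).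
  by rewrite /c; apply/andP; split; lra.
apply: (@rayleigh_inf_not_invertible _ _ _ Hip D f m2 (M1 * M2)) => //.
  by rewrite mulr_gt0 ?(res_gt0 hT1) ?(res_gt0 hT2).
(* [v] solves [((H - c)^2 - k^2) v = w], the equation of the form [f - m2 |.|^2]; the two factors
   are inverted at [c + k] and [c - k], both inside the gap. *)
move=> w [dw pw]; pose p := T2 w; pose v := T1 p.
have dp : dom H p by exact: res_dom hT2 w.
have dv : dom H v by exact: res_dom hT1 p.
exists v.
  apply: le_trans (res_bound hT1 _) _; rewrite -mulrA ler_pM2l ?(res_gt0 hT1) //.
  exact: res_bound hT2 _.
move=> t.
have pv : perp E (w + t%:C *: v).
  by apply/perpD/perpZ/(res_perp hT1) => //; apply/(res_perp hT2).
have hv := hm2 (w + t%:C *: v) (conj (domHD HS dw (domHZ HS _ dv)) pv).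
have ev : H v = p + (c + k)%:C *: v by exact: res_eq hT1 p.
have eP : H p = w + (c - k)%:C *: p by exact: res_eq hT2 w.
have s1 := H_sym HS dp dv; have s2 := H_sym HS dw dv; have s3 := H_sym HS dw dp.
move: hv s1 s2 s3.
rewrite /f (opHD HS) ?(opHZ HS) ?ev ?eP //; last exact: (domHZ HS _ dv).
rewrite /sqnorm !ripE kk.
rewrite (ripC ip v w) (ripC ip v p) (ripC ip p w) (ripC ip w (H w)).
rewrite (ripC ip p (H w)) (ripC ip v (H w)).
nra.
Qed.

Lemma not_spectrum_resolvent z : ~ spectrum H z -> resolvent_set H z.
Proof. by move=> h; apply: contrapT. Qed.

(** A spectral point outside the discrete spectrum is essential, hence at least [lambda_ess H]. *)
Lemma below_ess_isolated (m : R) : (m%:E < lambda_ess H)%E ->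
  ~ resolvent_set H m%:C ->
  exists2 e : R, 0 < e &
    forall z : R, 0 < `|z - m| < e -> resolvent_set H z%:C.
Proof.
move=> mess nres.
have [_ [e e0 he] _] : discrete_spectrum H m%:C.
  apply: contrapT => nd; move: mess; rewrite ltNge => /negP; apply.
  by apply: ereal_inf_lbound; exists m.
have er : e = (complex.Re e)%:C.
  by move: e0; case: e {he} => x y; rewrite ltcE /= => /andP[/eqP -> _].
exists (complex.Re e); first by rewrite -ltcR -er.
move=> z /andP[z0 ze]; apply: not_spectrum_resolvent => sz.
have zm : z%:C != m%:C.
  by apply: contraTneq z0 => /(@complexI R) ->; rewrite subrr normr0 ltxx.
have := he _ sz zm; rewrite er -rmorphB /=.
by rewrite normc_def /= expr0n addr0 sqrtr_sqr lecR leNgt ze.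
Qed.

End SpectralGap.

(** * Existence of eigenvectors below the essential spectrum *)

Section InverseIteration.
Context {R : realType} {V : completeNormedModType R[i]}.
Context (ip : {dot V for conjC}).
Context (Hip : induces_norm ip).
Context (H S : operator V) (HS : is_sqrt_operator ip H S).
Local Notation C := R[i].
Local Notation rip := (real_ip ip).
Local Notation sq := (sqnorm ip).
Local Notation perp := (orthogonal_to ip).

(* Inverse iteration: a point [m] at the bottom of the spectrum of [H] on the
   orthogonal complement of [E], isolated in the spectrum of [H], is an
   eigenvalue, and an eigenvector is the limit of [(d (H - m + d)^-1)^j u]
   for [u] whose Rayleigh quotient is close to [m]. *)
Lemma isolated_bottom_eigenvector E (m d : R) : eigenset H E -> 0 < d ->
  (forall z : R, 0 < `|z - m| < 3 * d -> resolvent_set H z%:C) ->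
  (forall u, dom S u -> perp E u -> m * sq u <= sq (S u)) ->
  (forall e : R, 0 < e ->
    exists2 u, dom S u /\ perp E u & sq (S u) < (m + e) * sq u) ->
  exists x, [/\ dom H x, H x = m%:C *: x, x != 0 & perp E x].
Proof.
move=> hE d0 hres hm hnear.
have [|T [M hT]] := resolventP HS (hres (m - d) _).
  rewrite addrAC subrr add0r normrN gtr0_norm // d0 /=; lra.
(* The accuracy [d / 9] keeps the limit away from zero: if it vanished, then [|u|^2 <= 9/4 |y0|^2],
   whereas [2 d |y0|^2 < d/9 |u|^2]. *)
have [|u [du pu] hu] := hnear (d / 9); first by rewrite divr_gt0.
have gap v : dom H v -> perp E v ->
    2 * d * (sq (S v) - m * sq v) <= sq (H v - m%:C *: v).
  apply: (spectral_gap_ineq Hip HS) => // z /andP[z1 z2].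
  by apply: hres; rewrite gtr0_norm ?subr_gt0 // ltrBlDl; apply/andP; split; lra.
pose T' v := d%:C *: T v.
have T'D : {morph T' : a b / a + b}.
  by move=> a b; rewrite /T' (res_add hT) scalerDr.
have T'N : {morph T' : a / - a}.
  by move=> a; rewrite /T' -scaleN1r (res_scale hT) scalerA mulrC -scalerA scaleN1r.
have T'H v : dom H (T' v) by apply: (domHZ HS); exact: res_dom hT v.
have T'p v : perp E v -> perp E (T' v).
  by move=> pv; apply/perpZ/(res_perp HS hT).
have T'E v : H (T' v) = d%:C *: v + (m - d)%:C *: T' v.
  rewrite (opHZ HS); last exact: res_dom hT v.
  by rewrite (res_eq hT) scalerDr scalerA mulrC -scalerA.
(* Differences of consecutive iterates of [u] are the iterates of [y0], so the limit of the iterates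
   of [u] is [u] minus the Neumann sum of [y0]. *)
pose y0 := u - T' u.
have pj j : perp E (iter j T' u) by elim: j => //= j IH; exact: T'p.
have yj j : iter j T' y0 = iter j T' u - T' (iter j T' u).
  by elim: j => //= j ->; rewrite T'D T'N.
pose z j := T (iter j T' u).
have zH j : dom H (z j) by exact: res_dom hT (iter j T' u).
have zp j : perp E (z j) by apply: (res_perp HS hT).
have yz j : iter j T' y0 = H (z j) - m%:C *: z j.
  by rewrite yj /z (res_eq hT) /T' rmorphB scalerBl [_ *: _ - _]addrC addrA addrK.
(* For the form [a[v] = |S v|^2 - m |v|^2], [y' = (H - m) z j.+1] gives [a(z j.+1, y') = |y'|^2].
   Cauchy-Schwarz for [a] and the gap bound [2 d a[z j.+1] <= |y'|^2] yield [2 d |y'|^2 <= a[y']].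
   As [a[y'] + d |y'|^2 = d (y, y')], the factor is 1/3. *)
have contr j : nr (iter j.+1 T' y0) <= 3^-1 * nr (iter j T' y0).
  set y := iter j T' y0; set y' := iter j.+1 T' y0.
  have y'E : y' = H (z j.+1) - m%:C *: z j.+1 by exact: yz.
  have y'T : y' = T' y by [].
  have dy : dom H y' by rewrite y'T.
  have py : perp E y'.
    by rewrite y'E -yz yj; apply/perpD/perpN/T'p.
  clearbody y y'.
  have g1 := gap _ (zH j.+1) (zp j.+1); rewrite -y'E in g1.
  have dz := domHS HS (zH j.+1); have dy' := domHS HS dy.
  have cs : sq y' ^+ 2 <= (sq (S y') - m * sq y') *
                          (sq (S (z j.+1)) - m * sq (z j.+1)).
    apply: sqr_le_of_quadratic_ge0 => t.
    have := hm (z j.+1 + t%:C *: y') (domSD HS dz (domSZ HS _ dy')).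
    have pt : perp E (z j.+1 + t%:C *: y') by apply/perpD/perpZ.
    move/(_ pt); rewrite (opSD HS) ?(opSZ HS) //; last exact: (domSZ HS).
    have e1 : rip (S (z j.+1)) (S y') = sq y' + m * rip (z j.+1) y'.
      by rewrite -(H_form HS) // /sqnorm {2}y'E !ripE; lra.
    rewrite /sqnorm !ripE (ripC ip (S y')) (ripC ip y' (z j.+1)) e1 /sqnorm; lra.
  have e2 : sq (S y') - m * sq y' + d * sq y' = d * rip y y'.
    rewrite /sqnorm -(H_form HS) // {1}y'T T'E -y'T !ripE; lra.
  have h0 : 0 <= sq (S y') - m * sq y' by rewrite subr_ge0 hm.
  have s0 := sq_ge0 ip y'.
  have h1 : 2 * d * sq y' <= sq (S y') - m * sq y'.
    have [s1|s1] := eqVneq (sq y') 0; first by rewrite {1}s1 mulr0.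
    have s2 : 0 < sq y' by rewrite lt_def s1.
    rewrite -(ler_pM2l s2); nra.
  have h2 : 3 * sq y' <= rip y y'.
    by rewrite -(ler_pM2l d0) -e2; lra.
  have h3 := rip_CS Hip y y'.
  rewrite -nr_sq // in h2.
  have := nr_ge0 y'; rewrite le_eqVlt => /orP[/eqP <-|n0].
    by rewrite mulr_ge0 ?nr_ge0.
  rewrite -(ler_pM2r n0); nra.
have hB v : nr (T' v) <= (d * M) * nr v.
  rewrite /T' nrZ gtr0_norm // -mulrA ler_pM2l //; exact: res_bound hT v.
have y0E : y0 = u - T' u by [].
clearbody y0 T'.
(* Since [(H - m) (T' u) = d y0], splitting [u = T' u + y0] in the same form produces the cross term
   [2 d |y0|^2]; the two diagonal terms are nonnegative. *)
have y0u : 2 * d * sq y0 <= sq (S u) - m * sq u.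
  have dTu : dom S (T' u) by apply: (domHS HS).
  have dy : dom S y0 by rewrite y0E; apply: (domSD HS) => //; exact: (domSN HS).
  have py : perp E y0 by rewrite y0E; apply/perpD/perpN/T'p.
  have := hm _ dy py; have := hm _ dTu (T'p _ pu).
  have e1 : rip (S (T' u)) (S y0) = d * sq y0 + m * rip (T' u) y0.
    have e2 : sq y0 = rip u y0 - rip (T' u) y0 by rewrite -ripNl -ripDl -y0E.
    by rewrite -(H_form HS) // T'E e2 !ripE; lra.
  have uE : u = T' u + y0 by rewrite y0E addrC subrK.
  have -> : sq (S u) = sq (S (T' u)) + 2 * rip (S (T' u)) (S y0) + sq (S y0).
    rewrite {1}uE (opSD HS) // /sqnorm !ripE (ripC ip (S y0)); lra.
  have -> : sq u = sq (T' u) + 2 * rip (T' u) y0 + sq y0.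
    rewrite {1}uE /sqnorm !ripE (ripC ip y0 (T' u)); lra.
  rewrite e1; lra.
have hq : 0 <= (3^-1 : R) < 1 by apply/andP; split; lra.
have [x' [hx1 hx2 hx3]] := neumann Hip T'D hB hq contr.
have px : perp E x'.
  move=> e Ee; apply: hx3 => j; rewrite yj.
  by have := perpD (pj j) (perpN (T'p _ (pj j))); apply.
pose x := u - x'.
have xT : x = T' x.
  rewrite /x T'D T'N; apply/eqP; rewrite subr_eq -addrA.
  by rewrite (addrC (- _)) hx1 addrC y0E subrK.
exists x; split.
- by rewrite xT.
- rewrite {1}xT T'E -xT rmorphB scalerBl; by rewrite addrC subrK.
- apply/eqP => x0.
  have ux : u = x' by apply/eqP; rewrite -subr_eq0 -/x x0.
  have su := sq_ge0 ip u; have n1 := nr_ge0 y0; have n2 := nr_ge0 u.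
  rewrite -ux in hx2.
  have h1 : nr u <= 3 / 2 * nr y0.
    apply: le_trans hx2 _; by rewrite le_eqVlt; apply/orP; left; apply/eqP; field.
  have h2 : sq u <= 9 / 4 * sq y0 by rewrite -!nr_sq //; nra.
  nra.
- by apply/perpD/perpN.
Qed.

(** The infimum of the Rayleigh quotient on the complement of [E] is at most [c], hence below the
    essential spectrum; not being a resolvent point, it is isolated, and inverse iteration
    applies. *)
Lemma bottom_eigenvector E (c : R) u : eigenset H E ->
  dom S u -> perp E u -> u != 0 -> sq (S u) <= c * sq u ->
  (c%:E < lambda_ess H)%E ->
  exists x m, [/\ dom H x, H x = m%:C *: x, x != 0, perp E x & m <= c].
Proof.
move=> hE du pu u0 huc hc.
have f0 v : 0 <= sq (S v) by exact: sq_ge0.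
have [m [m0 hm hnear]] :=
  rayleigh_inf ip (D := [set v | dom S v /\ perp E v]) f0 (conj du pu) u0.
have mc : m <= c.
  rewrite -(sq_gt0 ip) in u0; rewrite -(ler_pM2r u0).
  by apply: le_trans huc; apply: hm.
have mess : (m%:E < lambda_ess H)%E by apply: le_lt_trans hc; rewrite lee_fin.
have hm' v : dom S v -> perp E v -> m * sq v <= sq (S v).
  by move=> dv pv; apply: hm.
have nres := inf_not_resolvent Hip HS hE hm' hnear.
have [e e0 he] := below_ess_isolated mess nres.
have [||x [dx hx x0 px]] := @isolated_bottom_eigenvector E m (e / 3) hE _ _ hm' hnear.
- by rewrite divr_gt0.
- by move=> z hz; apply: he; rewrite mulrC divfK ?pnatr_eq0 // in hz.
by exists x, m.
Qed.

End InverseIteration.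

(** * Range of the square root *)

Section Range.
Context {R : realType} {V : completeNormedModType R[i]}.
Context (ip : {dot V for conjC}).
Context (Hip : induces_norm ip).
Context (H S : operator V) (HS : is_sqrt_operator ip H S).
Local Notation C := R[i].
Local Notation rip := (real_ip ip).
Local Notation sq := (sqnorm ip).
Local Notation perp := (orthogonal_to ip).

Lemma eigenset_kernel : eigenset H (opkernel H).
Proof. by move=> e [de He]; exists 0; rewrite scale0r. Qed.

Lemma eigenvalue_not_resolvent x (m : R) : dom H x -> H x = m%:C *: x ->
  x != 0 -> ~ resolvent_set H m%:C.
Proof.
move=> dx Hx x0 /(resolventP HS)[T [M hT]]; move/eqP: x0; apply.
rewrite -(res_inv hT dx) Hx subrr.
by have := res_scale hT 0 0; rewrite !scale0r.
Qed.

Lemma eigenvalue_ge0 x (m : R) : dom H x -> H x = m%:C *: x -> x != 0 -> 0 <= m.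
Proof.
move=> dx Hx; rewrite -(sq_gt0 ip) => x0.
have : 0 <= m * sq x.
  rewrite /sqnorm -ripZl -Hx (H_form HS dx (domHS HS dx)); exact: sq_ge0.
by rewrite pmulr_lge0.
Qed.

(** A smaller quotient would yield an eigenvector orthogonal to the kernel with eigenvalue in
    [[0, c]]. Eigenvalue zero would make it orthogonal to itself, and [(0, c]] consists of resolvent
    points. *)
Lemma coercive_off_kernel (e : R) : 0 < e -> (0 < lambda_ess H)%E ->
  (forall z : R, 0 < `|z - 0| < e -> resolvent_set H z%:C) ->
  exists2 c : R, 0 < c &
    forall u, dom S u -> perp (opkernel H) u -> c * sq u <= sq (S u).
Proof.
move=> e0 hess hres.
have [c [c0 ce cess]] : exists c : R, [/\ 0 < c, c < e & (c%:E < lambda_ess H)%E].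
  case: (lambda_ess H) hess => [x|_|//].
    rewrite lte_fin => x0; exists (minr e x / 2).
    have m0 : 0 < minr e x by rewrite lt_min e0.
    have m1 : minr e x <= e by rewrite ge_min lexx.
    have m2 : minr e x <= x by rewrite ge_min lexx orbT.
    by rewrite lte_fin; split; lra.
  by exists (e / 2); rewrite ltry; split => //; lra.
exists c => // u du pu; rewrite leNgt; apply/negP => hu.
have u0 : u != 0.
  rewrite -(sq_eq0 ip); apply/eqP => s0; move: hu.
  by rewrite s0 mulr0 ltNge sq_ge0.
have [x [m [dx Hx x0 px mc]]] :=
  bottom_eigenvector Hip HS eigenset_kernel du pu u0 (ltW hu) cess.
have := eigenvalue_ge0 dx Hx x0; rewrite le_eqVlt => /orP[/eqP m0|m0].
  move/eqP: x0; apply; apply/eqP; rewrite -(sq_eq0 ip) /sqnorm px //.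
  by split => //; rewrite Hx -m0 scale0r.
apply: (eigenvalue_not_resolvent dx Hx x0); apply: hres.
by rewrite subr0 gtr0_norm // m0 /=; apply: le_lt_trans ce.
Qed.

(** One solves [H w = v] and takes [z = S w]. If 0 is a spectral point, [w] is a Neumann sum for
    [d (H + d)^-1], which coercivity makes contracting on the complement of the kernel. *)
Lemma range_sqrt v : (0 < lambda_ess H)%E -> perp (opkernel H) v ->
  exists2 z, dom S z & S z = v.
Proof.
move=> hess pv.
have [|nres] := pselect (resolvent_set H (0 : R)%:C).
  move=> /(resolventP HS)[T [M hT]]; have dT := res_dom hT v.
  exists (S (T v)); first by case/(domHP HS): dT.
  by rewrite -(opHE HS dT) (res_eq hT) scale0r addr0.
have [e e0 he] := below_ess_isolated hess nres.
have [c c0 hc] := coercive_off_kernel e0 hess he.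
pose d := e / 2; have d0 : 0 < d by rewrite divr_gt0.
have [|T [M hT]] := resolventP HS (he (- d) _).
  by rewrite subr0 normrN gtr0_norm // d0 /d /=; lra.
pose T' u := d%:C *: T u.
have T'D : {morph T' : a b / a + b}.
  by move=> a b; rewrite /T' (res_add hT) scalerDr.
have hB u : nr (T' u) <= (d * M) * nr u.
  rewrite /T' nrZ gtr0_norm // -mulrA ler_pM2l //; exact: res_bound hT u.
have T'p u : perp (opkernel H) u -> perp (opkernel H) (T' u).
  by move=> pu; apply/perpZ/(res_perp HS hT) => //; exact: eigenset_kernel.
have pj j : perp (opkernel H) (iter j T' (T v)).
  elim: j => [|j IH] /=; last exact: T'p.
  by apply: (res_perp HS hT) => //; exact: eigenset_kernel.
have q01 : 0 <= d / (c + d) < 1.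
  apply/andP; split; first by rewrite divr_ge0 ?addr_ge0 ?ltW.
  by rewrite ltr_pdivrMr ?addr_gt0 // mul1r ltrDr.
have dT' u : dom H (T' u) by apply: (domHZ HS); exact: res_dom hT u.
have T'E u : H (T' u) = d%:C *: u - d%:C *: T' u.
  rewrite (opHZ HS); last exact: res_dom hT u.
  by rewrite (res_eq hT) scalerDr rmorphN scaleNr scalerN.
(* With [w = T' y], coercivity turns [|S w|^2 + d |w|^2 = d (y, w)] into
   [(c + d) |w|^2 <= d |y| |w|]. *)
have contr j : nr (iter j.+1 T' (T v)) <= d / (c + d) * nr (iter j T' (T v)).
  rewrite [iter j.+1 _ _]/=; have pyj := pj j.
  set y := iter j T' (T v) in pyj *.
  have h1 := hc _ (domHS HS (dT' y)) (T'p _ pyj).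
  have h2 : sq (S (T' y)) + d * sq (T' y) = d * rip y (T' y).
    rewrite /sqnorm -(H_form HS) //; last exact: (domHS HS).
    by rewrite T'E ripDl ripNl !ripZl; lra.
  have h3 := rip_CS Hip y (T' y).
  rewrite -!nr_sq // in h1 h2.
  have := nr_ge0 (T' y); rewrite le_eqVlt => /orP[/eqP <-|n0].
    by case/andP: q01 => q0 _; rewrite mulr_ge0 ?nr_ge0.
  rewrite mulrAC ler_pdivlMr ?addr_gt0 // -(ler_pM2r n0); nra.
have [z [hz _ _]] := neumann Hip T'D hB q01 contr.
have zE : z = T v + T' z by rewrite -hz subrK.
have dTv : dom H (T v) by exact: res_dom hT v.
have dz : dom H z by rewrite zE; apply: (domHD HS).
exists (S z); first by case/(domHP HS): dz.
rewrite -(opHE HS dz) {1}zE (opHD HS) // T'E (res_eq hT) -scalerBr.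
have -> : z - T' z = T v by [].
by rewrite rmorphN scaleNr subrK.
Qed.

End Range.

(** * Finite families of vectors and their Gram matrices *)

Lemma char_poly_conj (F : comNzRingType) n (P Q D : 'M[F]_n) :
  Q *m P = 1%:M -> char_poly (Q *m D *m P) = char_poly D.
Proof.
move=> QP; rewrite /char_poly.
have -> : char_poly_mx (Q *m D *m P) =
    map_mx polyC Q *m char_poly_mx D *m map_mx polyC P.
  rewrite /char_poly_mx !map_mxM mulmxBr mulmxBl; congr (_ - _).
  by rewrite -mulmxA -scalar_mxC mulmxA -map_mxM QP map_mx1 mul1mx.
rewrite !det_mulmx mulrAC -det_mulmx -map_mxM QP map_mx1 det1 mul1r //.
Qed.

Section Combinations.
Local Open Scope sesquilinear_scope.
Context {R : realType} {V : completeNormedModType R[i]}.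
Context (ip : {dot V for conjC}).
Local Notation C := R[i].
Local Notation rip := (real_ip ip).
Local Notation sq := (sqnorm ip).

Definition comb n (g : 'I_n -> V) (c : 'cV[C]_n) : V := \sum_j c j 0 *: g j.

Lemma comb_lin n (g : 'I_n -> V) a u v :
  comb g (a *: u + v) = a *: comb g u + comb g v.
Proof.
rewrite /comb scaler_sumr -big_split /=; apply: eq_bigr => j _.
by rewrite !mxE scalerDl scalerA.
Qed.

Lemma comb0 n (g : 'I_n -> V) : comb g 0 = 0.
Proof. by rewrite /comb big1 // => j _; rewrite mxE scale0r. Qed.

Lemma combZ n (g : 'I_n -> V) a u : comb g (a *: u) = a *: comb g u.
Proof. by have := comb_lin g a u 0; rewrite comb0 !addr0. Qed.

Lemma comb_delta n (g : 'I_n -> V) i : comb g (delta_mx i 0) = g i.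
Proof.
rewrite /comb (bigD1 i) //= big1 ?addr0 ?mxE ?eqxx ?scale1r //.
by move=> j ji; rewrite mxE (negPf ji) scale0r.
Qed.

Lemma ip_combl n (g : 'I_n -> V) a v : ip (comb g a) v = \sum_i a i 0 * ip (g i) v.
Proof.
by rewrite /comb linear_sumlz; apply: eq_bigr => i _; rewrite linearZl_LR.
Qed.

Lemma ip_conj u v : ip u v = conjC (ip v u).
Proof. by rewrite hermC /= expr0 mul1r. Qed.

Lemma ip_combr n (g : 'I_n -> V) a v :
  ip v (comb g a) = \sum_i conjC (a i 0) * ip v (g i).
Proof.
rewrite ip_conj ip_combl rmorph_sum; apply: eq_bigr => i _.
by rewrite rmorphM /= -ip_conj.
Qed.

Lemma ip0C u v : ip u v = 0 -> ip v u = 0.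
Proof. by move=> h; rewrite ip_conj h rmorph0. Qed.

Lemma comb_mul m n (g : 'I_n -> V) (B : 'M[C]_(n, m)) c :
  comb (fun j => comb g (col j B)) c = comb g (B *m c).
Proof.
rewrite /comb; under eq_bigr do rewrite scaler_sumr.
rewrite exchange_big; apply: eq_bigr => i _ /=.
rewrite mxE scaler_suml; apply: eq_bigr => j _.
by rewrite scalerA mxE mulrC.
Qed.

Definition join_fam m n (g : 'I_m -> V) (h : 'I_n -> V) (i : 'I_(m + n)) : V :=
  match fintype.split i with inl j => g j | inr j => h j end.

Lemma comb_join m n (g : 'I_m -> V) (h : 'I_n -> V) c :
  comb (join_fam g h) c = comb g (usubmx c) + comb h (dsubmx c).
Proof.
rewrite /comb big_split_ord /=; congr (_ + _); apply: eq_bigr => i _.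
  by rewrite /join_fam mxE; case: split_ordP => j;
    [move/lshift_inj ->|move/eqP; rewrite eq_lrshift].
by rewrite /join_fam mxE; case: split_ordP => j;
  [move/eqP; rewrite eq_rlshift|move/rshift_inj ->].
Qed.

(** There are [k] linear equations for [n > k] unknowns; a nonzero row of the left kernel of their
    matrix is a solution. *)
Lemma exists_orthogonal_comb n k (g : 'I_n -> V) (e : 'I_k -> V) : (k < n)%N ->
  exists2 c : 'cV[C]_n, c != 0 & forall j, ip (comb g c) (e j) = 0.
Proof.
move=> kn; pose M := \matrix_(i < n, j < k) ip (g i) (e j).
have K0 : kermx M != 0.
  rewrite -mxrank_eq0 mxrank_ker subn_eq0 -ltnNge.
  exact: leq_ltn_trans (rank_leq_col _) kn.
have [i ri] : exists i, row i (kermx M) != 0.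
  apply/existsP; rewrite -negb_forall; apply: contra K0 => /forallP h.
  by apply/eqP/row_matrixP => i; rewrite row0; exact/eqP.
exists (row i (kermx M))^T; first by rewrite -trmx0 (inj_eq trmx_inj).
move=> j; have : (row i (kermx M) *m M) 0 j = 0.
  by rewrite -row_mul mulmx_ker row0 mxE.
rewrite mxE => <-; rewrite ip_combl; apply: eq_bigr => l _.
by rewrite [_^T _ _]mxE [M _ _]mxE.
Qed.

(** The order of the indices fits conjugate linearity in the second argument and agrees with
    [adjoint_mul]. *)
Definition gram n (g : 'I_n -> V) : 'M[C]_n := \matrix_(i, j) ip (g j) (g i).

Lemma ip_comb n (g : 'I_n -> V) a b :
  ip (comb g a) (comb g b) = (b ^t* *m gram g *m a) 0 0.
Proof.
rewrite ip_combl mxE; apply: eq_bigr => i _; rewrite ip_combr mxE mulrC.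
congr (_ * _); apply: eq_bigr => j _.
by rewrite !mxE.
Qed.

(** Spectral theorem for a Hermitian matrix: the columns of [B] are eigenvectors, so the combined
    vectors are orthogonal, with the eigenvalues as squared norms. A dependent family only makes
    some [d i] vanish. *)
Lemma gram_diag n (g : 'I_n -> V) : exists (B : 'M[C]_n) (d : 'I_n -> R),
  [/\ B ^t* *m B = 1%:M, B *m B ^t* = 1%:M,
      forall i j, ip (comb g (col i B)) (comb g (col j B)) =
                  if i == j then (d i)%:C else 0 &
      char_poly (gram g) = \prod_i ('X - ((d i)%:C)%:P)].
Proof.
pose G := gram g.
have hG : G \is hermsymmx.
  apply/is_hermitianmxP; rewrite expr0 scale1r.
  by apply/matrixP => i j; rewrite !mxE ip_conj.
have /orthomx_spectralP GE := hermitian_normalmx hG.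
pose P := spectralmx G; pose D := spectral_diag G.
have PU : P \is unitarymx by exact: spectral_unitarymx.
have PP : P *m P ^t* = 1%:M by exact/unitarymxP.
have PP' : P ^t* *m P = 1%:M by rewrite -invmx_unitary // mulVmx ?unitarymx_unit.
rewrite invmx_unitary // -/P -/D in GE.
pose B := P ^t*.
have BtP : B ^t* = P by exact: trmxCK.
have hd : forall i j, ip (comb g (col i B)) (comb g (col j B)) =
   if i == j then D 0 i else 0.
  move=> i j; rewrite ip_comb.
  have -> : (col j B) ^t* = row j P.
    by apply/matrixP => a b; rewrite !mxE conjCK.
  rewrite -/G GE colE rowE -/B !mulmxA.
  rewrite -(mulmxA _ P B) PP mulmx1 -(mulmxA _ P B) PP mulmx1 -rowE -colE !mxE.
  by rewrite eq_sym; case: eqP => [->|]; rewrite ?mulr1n ?mulr0n.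
have dE i : D 0 i = (complex.Re (D 0 i))%:C.
  by have := hd i i; rewrite eqxx ip_sq => <-.
exists B, (fun i => complex.Re (D 0 i)); split.
- by rewrite BtP.
- by rewrite BtP.
- by move=> i j; rewrite hd -dE.
- rewrite -/G GE char_poly_conj // char_poly_trig ?diag_mx_is_trig //.
  by apply: eq_bigr => i _; rewrite -dE mxE eqxx mulr1n.
Qed.

(** The coefficients are computed in the orthogonal family [b] given by [gram_diag]; where [d j = 0]
    the vector [b j] is zero and the coefficient is set to 0. *)
Lemma comb_proj n (g : 'I_n -> V) (v : V) :
  exists c, forall j, ip (v - comb g c) (g j) = 0.
Proof.
have [B [d [BB BB' hd _]]] := gram_diag g.
pose b j := comb g (col j B).
pose a := \col_j (if d j == 0 then 0 else ip v (b j) / (d j)%:C).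
exists (B *m a) => j.
have hb k : ip (v - comb g (B *m a)) (b k) = 0.
  rewrite linearBl /= -comb_mul ip_combl (bigD1 k) //= big1 ?addr0.
    rewrite mxE hd eqxx; case: eqP => [d0|/eqP d0].
      have bk : b k = 0 by apply/eqP; rewrite -(dnorm_eq0 ip) hd eqxx d0.
      by rewrite bk linear0r mul0r subrr.
    by rewrite divfK ?subrr // (inj_eq (@complexI R)).
  by move=> i /negPf ik; rewrite hd ik mulr0.
have -> : g j = comb b (col j (B ^t*)).
  by rewrite comb_mul colE mulmxA BB' mul1mx comb_delta.
rewrite ip_combr big1 // => k _; by rewrite hb mulr0.
Qed.

Definition sqC (z : C) : R := complex.Re (z * conjC z).

Lemma sqCE z : (sqC z)%:C = z * conjC z.
Proof.
rewrite /sqC; case: z => x y /=; apply/eqP; rewrite eq_complex /= eqxx /=.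
by apply/eqP; ring.
Qed.

Lemma sqC_ge0 z : 0 <= sqC z.
Proof. by rewrite -lecR sqCE -normCK exprn_ge0. Qed.

Lemma sqC_eq0 z : sqC z = 0 -> z = 0.
Proof.
move=> h; apply/eqP; rewrite -normr_eq0 -sqrf_eq0 normCK -sqCE h.
by [].
Qed.

Lemma sqZ z u : sq (z *: u) = sqC z * sq u.
Proof.
apply: (@complexI R); rewrite rmorphM /= sqCE -!ip_sq.
by rewrite linearZl_LR linearZr_LR /= mulrA.
Qed.

Lemma sq_comb n (b : 'I_n -> V) (d : 'I_n -> R) c :
  (forall i j, ip (b i) (b j) = if i == j then (d i)%:C else 0) ->
  sq (comb b c) = \sum_i d i * sqC (c i 0).
Proof.
move=> hb; apply: (@complexI R); rewrite -ip_sq ip_combl rmorph_sum /=.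
apply: eq_bigr => i _; rewrite ip_combr (bigD1 i) //= big1 ?addr0 => [|j ji].
  by rewrite hb eqxx rmorphM /= sqCE mulrA mulrC.
by rewrite hb eq_sym (negPf ji) mulr0.
Qed.

Lemma sumsq_eq0 n (c : 'cV[C]_n) : \sum_i sqC (c i 0) = 0 -> c = 0.
Proof.
move/eqP; rewrite psumr_eq0 => [/allP h|i _]; last exact: sqC_ge0.
apply/matrixP => i j; rewrite ord1 mxE; apply/sqC_eq0/eqP.
exact: h (mem_index_enum i).
Qed.

End Combinations.

Lemma prod_XsubC_perm (R : realType) n (mu d : 'I_n -> R) :
  \prod_i ('X - ((mu i)%:C)%:P) = \prod_i ('X - ((d i)%:C)%:P) ->
  exists p : 'S_n, forall i, mu i = d (p i).
Proof.
move=> h.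
have /tuple_permP[p hp] : perm_eq [tuple (mu i)%:C | i < n] [tuple (d i)%:C | i < n].
  by apply: prod_XsubC_eq; rewrite !big_map -!enumT !big_enum.
exists p => i; apply: (@complexI R).
by have /(congr1 (fun t => tnth t i)) := val_inj hp; rewrite !tnth_mktuple.
Qed.

(** * Orthonormal eigenvectors and the min-max principle below the essential spectrum *)

Section MinMax.
Local Open Scope sesquilinear_scope.
Context {R : realType} {V : completeNormedModType R[i]}.
Context (ip : {dot V for conjC}).
Local Notation C := R[i].
Local Notation rip := (real_ip ip).
Local Notation sq := (sqnorm ip).
Local Notation perp := (orthogonal_to ip).

Lemma linear_comb n (f : {linear 'cV[C]_n -> V}) c :
  f c = comb (fun i => f (delta_mx i 0)) c.
Proof.
have cE : c = \sum_i c i 0 *: delta_mx i 0.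
  rewrite [LHS]matrix_sum_delta; apply: eq_bigr => i _.
  by rewrite big_ord_recl big_ord0 addr0.
by rewrite {1}cE linear_sum; apply: eq_bigr => i _; rewrite linearZ.
Qed.

(** Injectivity of [f] makes every [d i] of [gram_diag] positive, so the orthogonal family can be
    normalized. *)
Lemma orthonormal_basis (M : set V) m : has_dim M m ->
  exists o : 'I_m -> V, [/\ forall i, M (o i),
    forall i j, ip (o i) (o j) = (i == j)%:R &
    forall v, M v -> (forall i, ip v (o i) = 0) -> v = 0].
Proof.
move=> [f [fi fM]]; pose g i := f (delta_mx i 0).
have [B [d [BB BB' hd _]]] := gram_diag ip g.
have fg c : f c = comb g c by exact: linear_comb.
pose b i := comb g (col i B).
have d0 i : 0 < d i.
  have := hd i i; rewrite eqxx ip_sq => /(@complexI R) <-.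
  rewrite sq_gt0 -fg; apply/eqP => f0.
  have : col i B = 0 by apply: fi; rewrite f0 linear0.
  rewrite colE => /(congr1 (mulmx (B ^t*))); rewrite mulmxA BB mul1mx mulmx0.
  by move/matrixP/(_ i 0); rewrite !mxE !eqxx /= => /eqP; rewrite oner_eq0.
pose r i := (Num.sqrt (d i))^-1.
have rr i : r i * (r i * d i) = 1.
  rewrite mulrA -expr2 exprVn sqr_sqrtr ?ltW // mulVf // gt_eqF //.
pose o i := (r i)%:C *: b i.
exists o; split.
- by move=> i; rewrite /o /b -combZ -fg -fM; exists ((r i)%:C *: col i B).
- move=> i j; rewrite /o linearZl_LR linearZr_LR /= hd.
  case: eqP => [->|_]; last by rewrite !mulr0.
  have -> : ((r j)%:C)^* = (r j)%:C by rewrite conj_Creal // complex_real.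
  by rewrite -!rmorphM /= rr.
- move=> v; rewrite -fM => -[c _ <-] h0.
  have hb i : ip (f c) (b i) = 0.
    have := h0 i; rewrite /o linearZr_LR /= => /eqP; rewrite mulf_eq0.
    rewrite conjC_eq0 (inj_eq (@complexI R)) invr_eq0 sqrtr_eq0 leNgt d0 /=.
    by move/eqP.
  apply/eqP; rewrite -(dnorm_eq0 ip); apply/eqP.
  have e : f c = comb b (B ^t* *m c).
    by rewrite comb_mul mulmxA BB' mul1mx fg.
  by rewrite {2}e ip_combr big1 // => i _; rewrite hb mulr0.
Qed.

Context (H S : operator V) (HS : is_sqrt_operator ip H S).

Lemma domS_comb n (g : 'I_n -> V) c : (forall j, dom S (g j)) -> dom S (comb g c).
Proof.
move=> hg; rewrite /comb; elim/big_ind: _ => [|u v|j _].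
- exact: (domS0 HS).
- exact: (domSD HS).
- exact: (domSZ HS).
Qed.

Lemma opS_comb n (g : 'I_n -> V) c : (forall j, dom S (g j)) ->
  S (comb g c) = comb (fun j => S (g j)) c.
Proof.
move=> hg; rewrite /comb.
pose K u v := dom S u /\ S u = v.
suff: K (\sum_j c j 0 *: g j) (\sum_j c j 0 *: S (g j)) by case.
elim/big_ind2: _ => [|u1 u2 v1 v2 [h1 <-] [h2 <-]|j _].
- by split; [exact: (domS0 HS)|exact: (opS0 HS)].
- by split; [exact: (domSD HS)|exact: (opSD HS)].
- by split; [exact: (domSZ HS)|exact: (opSZ HS)].
Qed.

Lemma ip_eigen_neq u v (s t : R) : opeigenspace H s%:C u ->
  opeigenspace H t%:C v -> s != t -> ip u v = 0.
Proof.
move=> [du Hu] [dv Hv] st; have := H_sym_ip HS du dv.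
rewrite Hu Hv linearZl_LR linearZr_LR /= conj_Creal ?complex_real //.
move/eqP; rewrite -subr_eq0 -mulrBl -rmorphB mulf_eq0 (inj_eq (@complexI R)).
by rewrite subr_eq0 (negPf st) => /eqP.
Qed.

Context (lam : nat -> \bar R) (Hlam : enumerates_eigenvalues H lam).

(** For each value [t], the bijection of the indices with [lam i = t] onto [I_m] transports an
    orthonormal basis of the eigenspace; symmetry of [H] settles distinct values. *)
Lemma eigenbasis : exists e : nat -> V,
  [/\ forall i (t : R), lam i = t%:E -> (t%:E < lambda_ess H)%E ->
        opeigenspace H t%:C (e i),
      forall i j, (lam i < lambda_ess H)%E -> (lam j < lambda_ess H)%E ->
        ip (e i) (e j) = (i == j)%:R &
      forall (t : R) v, (t%:E < lambda_ess H)%E -> opeigenspace H t%:C v ->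
        (forall i, lam i = t%:E -> ip v (e i) = 0) -> v = 0].
Proof.
have [_ lam0 hdim] := Hlam.
have /choice[F hF] : forall t : R, exists e : nat -> V,
    (t%:E < lambda_ess H)%E ->
    [/\ forall i, lam i = t%:E -> opeigenspace H t%:C (e i),
        forall i j, lam i = t%:E -> lam j = t%:E -> ip (e i) (e j) = (i == j)%:R &
        forall v, opeigenspace H t%:C v ->
          (forall i, lam i = t%:E -> ip v (e i) = 0) -> v = 0].
  move=> t; have [tl|ntl] := pselect (t%:E < lambda_ess H)%E; last by exists (fun=> 0).
  have [m hm /card_set_bijP[f [f1 f2 f3]]] := hdim t tl.
  have [b [b1 b2 b3]] := orthonormal_basis hm.
  have fm i : lam i = t%:E -> (f i < m)%N by move=> h; exact: f1.
  (* The default [0] is reached only at indices with [lam i != t], about which nothing is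
     claimed. *)
  exists (fun i => if insub (f i) is Some k then b k else 0) => _; split.
  - by move=> i /fm h; rewrite insubT.
  - move=> i j hi hj; rewrite !insubT ?fm // => h1 h2.
    rewrite b2 -val_eqE /=; congr ((_ : bool)%:R).
    by apply/eqP/eqP => [|-> //]; apply: f2; rewrite inE.
  - move=> v hv h; apply: b3 => // k.
    have [i hi fi] := f3 k (ltn_ord k).
    have := h i hi; rewrite insubT; first by rewrite fi.
    by move=> hk; have -> : Sub (f i) hk = k by apply: val_inj; rewrite /= fi.
have lamr i : (lam i < lambda_ess H)%E -> exists t : R, lam i = t%:E.
  move=> h; exists (fine (lam i)); rewrite fineK // fin_numE.
  have /andP[h0 _] := lam0 i; apply/andP; split.
    by apply: contraTneq h0 => ->.
  by apply: contraTneq h => ->; rewrite -leNgt leey.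
exists (fun i => F (fine (lam i)) i); split.
- by move=> i t ht tl; rewrite ht /=; have [h _ _] := hF t tl; apply: h.
- move=> i j hi hj; have [s  hs] := lamr i hi; have [t  ht] := lamr j hj.
  rewrite hs ht /= in hi hj *; have [hs1 hs2 _] := hF s hi.
  have [st|nst] := eqVneq s t; first by rewrite -st in ht *; apply: hs2.
  have [ht1 _ _] := hF t hj.
  rewrite (ip_eigen_neq (hs1 _ hs) (ht1 _ ht) nst).
  case: eqP => // ij; move: hs; rewrite ij ht => -[ts].
  by rewrite ts eqxx in nst.
- move=> t v tl hv h; have [_ _ h3] := hF t tl; apply: h3 => // i hi.
  by have := h i hi; rewrite hi.
Qed.

Context (Hip : induces_norm ip).

(** If [t < lam k], the chosen eigenvectors for values at most [t] are among the first [k], and some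
    nonzero vector of the span is orthogonal to them. Then [bottom_eigenvector] yields an
    eigenvector with eigenvalue at most [t] that is orthogonal to its own eigenspace, which is
    absurd. *)
Lemma lam_le_of_subspace k (g : 'I_k.+1 -> V) (t : R) :
  (forall j, dom S (g j)) ->
  (forall c, c != 0 -> comb g c != 0 /\ sq (S (comb g c)) <= t * sq (comb g c)) ->
  (lam k <= t%:E)%E.
Proof.
move=> dg hg; rewrite leNgt; apply/negP => tk.
have [lamS lam0 _] := Hlam.
have tess : (t%:E < lambda_ess H)%E by have /andP[_] := lam0 k; exact: lt_le_trans.
have [e [e1 _ e3]] := eigenbasis.
have [c c0 hc] := exists_orthogonal_comb ip g (fun j : 'I_k => e j) (leqnn _).
have [u0 hu] := hg c c0.
(* Complex multiples are included so that [perp E] amounts to complex orthogonality. *)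
pose E := [set w | exists (a : C) i, (lam i <= t%:E)%E /\ w = a *: e i].
have hE : eigenset H E.
  move=> _ [a [i [it ->]]]; have /andP[i0 _] := lam0 i.
  have li : lam i = (fine (lam i))%:E.
    by rewrite fineK // fin_numE; apply/andP; split;
      [apply: contraTneq i0 => ->|apply: contraTneq it => ->].
  exists (fine (lam i)).
  have [|de He] := e1 i _ li; first by rewrite -li; apply: le_lt_trans tess.
  split; first exact: (domHZ HS).
  by rewrite (opHZ HS) // He !scalerA mulrC.
have pu : perp E (comb g c).
  move=> _ [a [i [it ->]]]; apply: ip_ripZ.
  have ik : (i < k)%N.
    rewrite ltnNge; apply/negP => /lamS ki.
    by move: tk; rewrite ltNge (le_trans ki it).
  exact: (hc (Ordinal ik)).
have [x [m [dx Hx x0 px mt]]] :=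
  bottom_eigenvector Hip HS hE (domS_comb c dg) pu u0 hu tess.
move/eqP: x0; apply; apply: (e3 m) => //.
  by apply: le_lt_trans tess; rewrite lee_fin.
move=> i hi; have it : (lam i <= t%:E)%E by rewrite hi lee_fin.
apply: ip_rip0; apply: px; last by exists 'i, i.
by exists 1, i; rewrite scale1r.
Qed.

End MinMax.

(** * Orthogonal projections and gaps between subspaces *)

Section Angle.
Context {R : realType} {V : completeNormedModType R[i]}.
Context (ip : {dot V for conjC}).
Context (Hip : induces_norm ip).
Local Notation C := R[i].
Local Notation rip := (real_ip ip).
Local Notation sq := (sqnorm ip).
Local Notation proj := (orthoproj ip).

(** A relation, because [orthoproj] falls back on [0] when no projection exists. *)
Definition is_proj (M : set V) (x y : V) : Prop :=
  M y /\ forall m, M m -> ip (x - y) m = 0.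

Lemma orthoproj_eq M x y : is_proj M x y -> proj M x = y.
Proof.
move=> hy; have [h1 h2] : is_proj M x (proj M x) by apply: xgetPex; exists y.
case: hy => y1 y2; set p := proj M x in h1 h2 *.
have h m : M m -> ip (p - y) m = 0.
  move=> Mm; have -> : p - y = (x - y) - (x - p) by rewrite opprB [RHS]addrC subrKA.
  by rewrite linearBl /= y2 // h2 // subr0.
apply/eqP; rewrite -subr_eq0 -(dnorm_eq0 ip) linearBr /=.
by rewrite h // h // subrr.
Qed.

Lemma orthoproj_cases M x : is_proj M x (proj M x) \/ proj M x = 0.
Proof.
have [[y hy]|h] := pselect (exists y, is_proj M x y).
  by left; apply: xgetPex; exists y.
by right; apply: xgetPN => y hy; apply: h; exists y.
Qed.

Lemma pythagoras u v : rip u v = 0 -> sq (u + v) = sq u + sq v.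
Proof. by move=> h; rewrite /sqnorm !ripE (ripC ip v u) h; lra. Qed.

Lemma ler_nr u v : (nr u <= nr v) = (sq u <= sq v).
Proof. by rewrite -!(nr_sq Hip) ler_pXn2r // nnegrE nr_ge0. Qed.

Lemma nr_proj M x : nr (proj M x) <= nr x /\ nr (x - proj M x) <= nr x.
Proof.
have [[h1 h2]|->] := orthoproj_cases M x; last first.
  by rewrite nr0 subr0 nr_ge0.
have h : rip (x - proj M x) (proj M x) = 0 by rewrite /real_ip h2.
have := pythagoras h; rewrite subrK !ler_nr => ->.
by split; rewrite ?lerDl ?lerDr sq_ge0.
Qed.

Local Notation angle M1 M2 := (opnorm (fun x => proj M1 (x - proj M2 x))).

Lemma angle_ub M1 M2 x : nr x <= 1 -> nr (proj M1 (x - proj M2 x)) <= angle M1 M2.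
Proof.
move=> x1; apply: ub_le_sup; last by exists x => //=; rewrite normE lecR.
exists 1 => _ [y /= hy <-]; rewrite normE lecR in hy.
have [h1 _] := nr_proj M1 (y - proj M2 y); have [_ h2] := nr_proj M2 y.
exact: le_trans h1 (le_trans h2 hy).
Qed.

Lemma angle_ge0 M1 M2 : 0 <= angle M1 M2.
Proof.
by apply: le_trans (nr_ge0 _) (@angle_ub M1 M2 0 _); rewrite nr0.
Qed.

Lemma angle_le1 M1 M2 : angle M1 M2 <= 1.
Proof.
apply: ge_sup; first by exists (complex.Re `|proj M1 (0 - proj M2 0)|), 0; rewrite //= normr0.
move=> _ [y /= hy <-]; rewrite normE lecR in hy.
have [h1 _] := nr_proj M1 (y - proj M2 y); have [_ h2] := nr_proj M2 y.
exact: le_trans h1 (le_trans h2 hy).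
Qed.

(** For a unit vector [g] orthogonal to [M2], [P2 g = 0], so the gap bounds [|P1 g|]; moreover
    [(m, g) = (m, P1 g)]. *)
Lemma angle_bound (M1 M2 : set V) m g : (forall x, exists y, is_proj M1 x y) ->
  M2 0 -> M1 m -> (forall w, M2 w -> ip g w = 0) ->
  rip m g <= angle M1 M2 * (nr m * nr g).
Proof.
move=> P1ex M20 Mm gM2.
have [->|g0] := eqVneq g 0; first by rewrite rip0r nr0 !mulr0.
have n0 : 0 < nr g by rewrite lt_def nr_ge0 nr_eq0 g0.
pose g1 := ((nr g)^-1)%:C *: g.
have n1 : nr g1 = 1 by rewrite nrZ gtr0_norm ?invr_gt0 // mulVf // gt_eqF.
have p2 : proj M2 g1 = 0.
  apply: orthoproj_eq; split => // w Mw.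
  by rewrite subr0 linearZl_LR /= gM2 // mulr0.
have [y hy] := P1ex g1.
have h1 : nr y <= angle M1 M2.
  have := @angle_ub M1 M2 g1; rewrite p2 subr0 (orthoproj_eq hy) n1.
  exact.
have h2 : rip m g1 = rip m y.
  have [_ /(_ m Mm) h] := hy; rewrite !(ripC ip m) -[g1 in LHS](subrK y) ripDl.
  by rewrite {1}/real_ip h add0r.
have gE : g = (nr g)%:C *: g1.
  by rewrite scalerA -rmorphM /= divff ?scale1r // gt_eqF.
rewrite {1}gE ripZr h2 (mulrC (nr g)) mulrA ler_wpM2r ?nr_ge0 //.
apply: le_trans (rip_CS Hip _ _) _; rewrite mulrC ler_wpM2r ?nr_ge0 //.
Qed.

Lemma sqnorm_eq0 u : sq u = 0 -> u = 0.
Proof. by move/eqP; rewrite sq_eq0 => /eqP. Qed.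

(* If [P1] maps [M2] onto [M1] then the gap from [M1] to [M2] is at most the
   gap from [M2] to [M1]. *)
Lemma angle_bound_sym (M1 M2 : set V) m w g : (forall x, exists y, is_proj M2 x y) ->
  M1 0 -> M2 w -> is_proj M1 w m -> (forall v, M2 v -> ip g v = 0) ->
  rip m g <= angle M2 M1 * (nr m * nr g).
Proof.
move=> P2ex M10 Mw [Mm hm] gM2; set b := angle M2 M1.
have b0 : 0 <= b by exact: angle_ge0.
have r0 : rip (w - m) m = 0 by rewrite /real_ip hm.
(* [w - m] is orthogonal to [M1], so [angle_bound] applies with the two sets exchanged; it leads to
   [|m|^2 >= (1 - b^2) |w|^2]. *)
have h1 : sq (w - m) <= b * (nr w * nr (w - m)).
  have -> : sq (w - m) = rip w (w - m).
    by rewrite /sqnorm {1}ripDl ripNl (ripC ip m) r0 subr0.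
  exact: angle_bound.
have h2 : sq w = sq (w - m) + sq m by have := pythagoras r0; rewrite subrK.
have h3 : nr (w - m) <= b * nr w.
  have := nr_ge0 (w - m); rewrite le_eqVlt => /orP[/eqP <-|n0].
    by rewrite mulr_ge0 ?nr_ge0.
  by rewrite -(ler_pM2r n0) -mulrA -expr2 (nr_sq Hip).
have h4 : sq (w - m) <= b ^+ 2 * sq w.
  rewrite -!(nr_sq Hip) -exprMn ler_pXn2r // nnegrE ?mulr_ge0 ?nr_ge0 //.
have [w0|w0] := eqVneq (sq w) 0.
  have m0 : m = 0.
    apply: sqnorm_eq0; have := sq_ge0 ip (w - m); have := sq_ge0 ip m; lra.
  by rewrite m0 rip0l nr0 mul0r mulr0.
have wp : 0 < sq w by rewrite lt_def w0 sq_ge0.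
(* [a w] is the projection of [m] on [w], as [(w, m) = |m|^2]. Removing it leaves the pairing with
   [g] unchanged and gives [|m - a w|^2 = (1 - a) |m|^2 <= b^2 |m|^2]. *)
pose a := sq m / sq w.
have -> : rip m g = rip (m - a%:C *: w) g.
  rewrite ripDl ripNl ripZl (ripC ip w) {3}/real_ip gM2 //= mulr0 subr0 //.
apply: le_trans (rip_CS Hip _ _) _; rewrite mulrA ler_wpM2r ?nr_ge0 //.
have h5 : sq (m - a%:C *: w) = sq m - a * sq m.
  have e : rip w m = sq m.
    by move: r0; rewrite ripDl ripNl => /eqP; rewrite subr_eq0 => /eqP.
  rewrite /sqnorm !ripE (ripC ip m w) e -/(sq m) -/(sq w).
  have : a * sq w = sq m by rewrite divfK.
  by rewrite /sqnorm => ->; lra.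
rewrite -(@ler_pXn2r _ 2) // ?nnegrE ?mulr_ge0 ?nr_ge0 // exprMn !(nr_sq Hip) h5.
have h6 : (1 - b ^+ 2) <= a by rewrite /a ler_pdivlMr //; lra.
have := sq_ge0 ip m; nra.
Qed.

End Angle.

(** * The principal angle as a bound for the form between [ran X] and its complement *)

Section FormAngle.
Context {R : realType} {V : completeNormedModType R[i]}.
Context (ip : {dot V for conjC}).
Context (Hip : induces_norm ip).
Context (H S : operator V) (HS : is_sqrt_operator ip H S).
Local Notation C := R[i].
Local Notation rip := (real_ip ip).
Local Notation sq := (sqnorm ip).
Local Notation proj := (orthoproj ip).

Lemma is_proj_comb n (g : 'I_n -> V) (M : set V) x :
  (forall y, M y <-> exists c, y = comb g c) ->
  exists c, is_proj ip M x (comb g c).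
Proof.
move=> hM; have [c hc] := comb_proj ip g x; exists c; split.
  by apply/hM; exists c.
move=> m /hM[a ->]; rewrite ip_combr big1 // => i _; by rewrite hc mulr0.
Qed.

Lemma kernelP x : opkernel H x <-> dom S x /\ S x = 0.
Proof.
split=> [[dx Hx]|[dx Sx]].
  split; first exact: (domHS HS).
  apply: (@sqnorm_eq0 _ _ ip).
  by rewrite /sqnorm -(H_form HS) ?Hx ?rip0l //; exact: (domHS HS).
have dH : dom H x by apply/(domHP HS); rewrite Sx; split => //; exact: (domS0 HS).
by split => //; rewrite (opHE HS) // Sx (opS0 HS).
Qed.

Context (n r : nat) (X : {linear 'cV[C]_n -> V}).
Context (Xiso : isometry_from_Cn X).
Context (XS : range X `<=` dom S).
Local Notation g := (fun j => X (delta_mx j 0)).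

Lemma isometry_inj c : X c = 0 -> c = 0.
Proof.
move=> Xc; have := Xiso c; rewrite Xc normr0 expr0n /= => /esym/eqP.
rewrite psumr_eq0 => [/allP h|i _]; last by rewrite exprn_ge0.
apply/matrixP => i j; rewrite ord1 mxE; apply/eqP.
by have := h i (mem_index_enum i); rewrite /= expf_eq0 normr_eq0.
Qed.

Lemma domSX c : dom S (X c). Proof. by apply: XS; exists c. Qed.

Lemma opSX c : S (X c) = comb (fun j => S (g j)) c.
Proof. by rewrite linear_comb (opS_comb HS) // => j; exact: domSX. Qed.

Context (kerH : has_dim (opkernel H) r).
Context (ess0 : (0 < lambda_ess H)%E).

(** The inverse image is the kernel plus preimages of the vectors of [ran X] orthogonal to it. The
    kernel has dimension [r], and [r] equations cut out those vectors, leaving at least [n - r]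
    dimensions. *)
Lemma inv_image_basis : exists N (h : 'I_N -> V), [/\ (n <= N)%N,
  forall y, inv_image S (range X) y <-> exists c, y = comb h c &
  forall c, comb h c = 0 -> c = 0].
Proof.
have [f [f_inj f_ker]] := kerH.
pose k i := f (delta_mx i 0).
have fk c : f c = comb k c by exact: linear_comb.
have kker c : opkernel H (comb k c) by rewrite -fk -f_ker; exists c.
have kS c : dom S (comb k c) /\ S (comb k c) = 0 by apply/kernelP.
(* The left kernel of [K] consists of the coordinates of the vectors of [ran X] orthogonal to the
   kernel of [H]. *)
pose K : 'M[C]_(n, r) := \matrix_(i, j) ip (g i) (k j).
pose A := row_base (kermx K).
have ker0 c : (forall j, ip (X c) (k j) = 0) <-> c^T *m K = 0.
  split=> [h|h].
    apply/matrixP => i j; rewrite ord1 [RHS]mxE; apply: etrans (h j).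
    rewrite linear_comb ip_combl mxE.
    by apply: eq_bigr => l _; rewrite !mxE.
  move=> j; rewrite linear_comb ip_combl.
  move/matrixP: h => /(_ 0 j); rewrite mxE [X in _ = X -> _]mxE; apply: etrans.
  by apply: eq_bigr => l _; rewrite !mxE.
pose x b := X (row b A)^T.
have /choice[z hz] : forall b, exists z, dom S z /\ S z = x b.
  move=> b; have [|z dz Sz] := range_sqrt Hip HS (v := x b) ess0; last by exists z.
  move=> e; rewrite -f_ker => -[c _ <-].
  rewrite /real_ip fk ip_combr big1 // => j _.
  have -> : ip (x b) (k j) = 0; last by rewrite mulr0.
  apply: (ker0 _).2; rewrite trmxK; apply/sub_kermxP.
  by apply: submx_trans (row_sub _ _) _; rewrite eq_row_base.
pose h := join_fam k z.
have hE c : comb h c = comb k (usubmx c) + comb z (dsubmx c) by exact: comb_join.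
have zS w : dom S (comb z w) /\ S (comb z w) = X (A^T *m w).
  split; first by apply: (domS_comb HS) => j; case: (hz j).
  rewrite (opS_comb HS); last by move=> j; case: (hz j).
  rewrite linear_comb -comb_mul; congr comb; apply: funext => j.
  by case: (hz j) => _ ->; rewrite /x linear_comb tr_row.
have hS c : dom S (comb h c) /\ S (comb h c) = X (A^T *m dsubmx c).
  have [k1 k2] := kS (usubmx c); have [z1 z2] := zS (dsubmx c).
  by rewrite hE (opSD HS) // k2 z2 add0r; split => //; exact: (domSD HS).
exists _, h; split.
- rewrite mxrank_ker -leq_subLR; apply: leq_sub2l; exact: rank_leq_col.
- move=> y; split=> [[dy [c _ Xc]]|[c ->]]; last first.
    by have [h1 h2] := hS c; split; rewrite ?h2 //; exists (A^T *m dsubmx c).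
  have /ker0/sub_kermxP : forall j, ip (X c) (k j) = 0.
    move=> j; have [k1 k2] := kS (delta_mx j 0); rewrite comb_delta in k1 k2.
    by rewrite Xc (S_sym_ip HS) // k2 linear0r.
  rewrite -(eq_row_base (kermx K)) -/A => /submxP[w cw].
  have [z1 z2] := zS w^T.
  have : opkernel H (y - comb z w^T).
    apply/kernelP; rewrite (opSD HS) // ?(opSN HS) // ?z2; last exact: (domSN HS).
    split; first by apply: (domSD HS) => //; exact: (domSN HS).
    by rewrite -Xc -trmx_mul -cw trmxK subrr.
  rewrite -f_ker => -[a _]; rewrite fk => ha.
  exists (col_mx a w^T); rewrite hE col_mxKu col_mxKd ha subrK //.
- move=> c c0; have [_] := hS c; rewrite c0 (opS0 HS) => /esym/isometry_inj.
  move=> /(congr1 trmx); rewrite trmx_mul trmxK trmx0 => hA.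
  have d0 : dsubmx c = 0.
    apply: trmx_inj; rewrite trmx0; apply/eqP.
    by rewrite -(mulmx_free_eq0 _ (row_base_free (kermx K))) hA.
  rewrite hE d0 comb0 addr0 -fk in c0.
  have u0 : usubmx c = 0 by apply: f_inj; rewrite c0 linear0.
  by rewrite -[c]vsubmxK u0 d0 col_mx0.
Qed.

Local Notation M1 := (S @` range X).
Local Notation M2 := (inv_image S (range X)).

Lemma imageP y : M1 y <-> exists c, y = comb (fun j => S (g j)) c.
Proof.
split=> [[_ [c _ <-] <-]|[c ->]]; first by exists c; rewrite opSX.
by exists (X c); [exists c|rewrite opSX].
Qed.

Lemma sin_max_principal_angle : sin (max_principal_angle ip M1 M2) =
  minr (opnorm (fun x => proj M1 (x - proj M2 x)))
       (opnorm (fun x => proj M2 (x - proj M1 x))).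
Proof.
rewrite /max_principal_angle asinK // in_itv /= le_min ge_min.
rewrite (angle_le1 Hip) /= !(le_trans _ (angle_ge0 Hip _ _)) //; lra.
Qed.

Let s := sin (max_principal_angle ip M1 M2).

Lemma sin_angle_ge0 : 0 <= s.
Proof. by rewrite /s sin_max_principal_angle le_min !(angle_ge0 Hip). Qed.

(** Symmetry of [S] makes [S y] orthogonal to [M2], so one gap applies directly. If the minimum is
    the other gap [b < 1], every vector of [M1] is the projection of a vector of [M2], and
    [angle_bound_sym] exchanges the gaps. *)
Lemma form_angle c y : s < 1 -> dom S y -> (forall a, ip (X a) y = 0) ->
  rip (S (X c)) (S y) <= s * (nr (S (X c)) * nr (S y)).
Proof.
move=> s1 dy yX.
have gM2 w : M2 w -> ip (S y) w = 0.
  by move=> [dw [a _ Xa]]; rewrite (S_sym_ip HS) // -Xa; apply: ip0C.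
have P1ex x : exists y, is_proj ip M1 x y.
  by have [a ha] := is_proj_comb x imageP; exists (comb (fun j => S (g j)) a).
have M1c : M1 (S (X c)) by exists (X c) => //; exists c.
move: s1; rewrite /s sin_max_principal_angle.
set a := opnorm _; set b := opnorm _; case: (leP a b) => [ab _|ba b1].
  apply: angle_bound => //; split; first exact: (domS0 HS).
  by exists 0; rewrite // linear0 (opS0 HS).
have [N [h [nN hM2 h_inj]]] := inv_image_basis.
have P2ex x : exists y, is_proj ip M2 x y.
  by have [e he] := is_proj_comb x hM2; exists (comb h e).
have /choice[p hp] : forall i, exists p, is_proj ip M1 (h i) (comb (fun j => S (g j)) p).
  by move=> i; exact: is_proj_comb imageP.
pose A := \matrix_(i < n, j < N) p j i 0.
have hA e : is_proj ip M1 (comb h e) (comb (fun j => S (g j)) (A *m e)).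
  split; first by apply/imageP; exists (A *m e).
  move=> m Mm; rewrite -comb_mul linearBl /= !ip_combl -sumrB big1 // => i _.
  have -> : col i A = p i by apply/matrixP => j l; rewrite ord1 !mxE.
  have [_ /(_ m Mm)] := hp i; rewrite linearBl /= -mulrBr => ->.
  by rewrite mulr0.
(* A vector [v] of [M2] with zero projection is orthogonal to [M1], so [|v|^2 <= b |v|^2] and
   [v = 0]. The projection is thus injective on [M2], and [n <= N] makes [A] surjective. *)
have A_free : row_free A^T.
  rewrite -kermx_eq0; apply/eqP/row_matrixP => i; rewrite row0; apply: trmx_inj.
  rewrite trmx0; apply: h_inj; set e := _^T.
  have Ae : A *m e = 0.
    by apply: trmx_inj; rewrite trmx_mul trmxK -row_mul mulmx_ker row0 trmx0.
  have [_] := hA e; rewrite Ae comb0 subr0 => he; apply: (@sqnorm_eq0 _ _ ip).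
  have M2e : M2 (comb h e) by apply/hM2; exists e.
  have M20 : M1 0 by exists 0; [exists 0; rewrite // linear0|exact: (opS0 HS)].
  have := angle_bound Hip P2ex M20 M2e he.
  rewrite -/b -expr2 (nr_sq Hip) -/(sq _) => hb.
  have := sq_ge0 ip (comb h e); rewrite le_eqVlt => /orP[/eqP //|s0].
  by nra.
have A_full : row_full A^T.
  move: A_free; rewrite /row_free /row_full => /eqP rA.
  by rewrite eqn_leq rank_leq_col /= rA.
have /submxP[w cw] : (c^T <= A^T)%MS by rewrite submx_full.
have cE : c = A *m w^T by rewrite -[LHS]trmxK cw trmx_mul trmxK.
have hAw := hA w^T; rewrite -cE -opSX in hAw.
apply: (@angle_bound_sym _ _ ip Hip M1 M2 _ (comb h w^T)) => //.
  by exists 0; [exists 0; rewrite // linear0|exact: (opS0 HS)].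
by apply/hM2; exists w^T.
Qed.

End FormAngle.

(** * Ritz vectors *)

Section RitzBasis.
Local Open Scope sesquilinear_scope.
Context {R : realType} {V : completeNormedModType R[i]}.
Context (ip : {dot V for conjC}).
Context (Hip : induces_norm ip).
Context (H S : operator V) (HS : is_sqrt_operator ip H S).
Local Notation C := R[i].
Local Notation rip := (real_ip ip).
Local Notation sq := (sqnorm ip).
Context (n r : nat) (X : {linear 'cV[C]_n -> V}).
Context (Xiso : isometry_from_Cn X).
Context (XS : range X `<=` dom S).
Context (mu : 'I_n -> R).
Context (Hmu : ordered_eigenvalues (adjoint_mul ip (fun c => S (X c))) mu).

(** Polarization: the norms of the images of [e_j + a e_i], with [a = 1] and [a = 'i], determine
    both parts of the inner product. *)
Lemma isometry_gram : gram ip (fun j => X (delta_mx j 0)) = 1%:M.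
Proof.
have hsq c : sq (X c) = \sum_j sqC (c j 0).
  apply: (@complexI R); rewrite -ip_sq -Hip Xiso rmorph_sum /=.
  by apply: eq_bigr => j _; rewrite sqCE normCK.
have sq1 i (a : C) : sq (X (a *: delta_mx i 0)) = sqC a.
  rewrite hsq (bigD1 i) //= big1 ?addr0 => [|j ji].
    by rewrite !mxE !eqxx mulr1.
  by rewrite !mxE (negPf ji) mulr0 /sqC mul0r.
apply/matrixP => i j; rewrite !mxE; have [<-|ij] := eqVneq i j.
  by have := sq1 i 1; rewrite scale1r ip_sq => ->; rewrite sqCE mul1r conjC1.
have rip0 (a : C) : rip (X (delta_mx j 0)) (a *: X (delta_mx i 0)) = 0.
  have := hsq (delta_mx j 0 + a *: delta_mx i 0).
  rewrite (bigD1 i) // (bigD1 j) /=; last by rewrite eq_sym.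
  rewrite big1 => [|k /andP[ki kj]]; last first.
    by rewrite !mxE (negPf ki) (negPf kj) mulr0 addr0 /sqC mul0r.
  rewrite !mxE !eqxx (negPf ij) eq_sym (negPf ij) /= mulr0 mulr1 !addr0 add0r.
  have := sq1 i a; have := sq1 j 1; rewrite scale1r linearD linearZ /= => <- <-.
  by rewrite /sqnorm !ripE (ripC ip (a *: _)); lra.
apply: ip_rip0; last exact: rip0.
by rewrite -[X (delta_mx i 0)]scale1r.
Qed.

(** A unitary diagonalization of [Xi] is carried to [ran X] by the isometry, which keeps the columns
    orthonormal; a permutation of the columns puts their values in the order of [mu]. *)
Lemma ritz_basis : exists x : 'I_n -> V,
  [/\ forall c, exists a, X c = comb x a, forall a, exists c, comb x a = X c,
      forall i j, ip (x i) (x j) = if i == j then (1 : R)%:C else 0 &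
      forall i j, ip (S (x i)) (S (x j)) = if i == j then (mu i)%:C else 0].
Proof.
pose g j := X (delta_mx j 0).
have [B [d [BB BB' hd hchar]]] := gram_diag ip (fun j => S (g j)).
have [_] := Hmu.
have -> : adjoint_mul ip (fun c => S (X c)) = gram ip (fun j => S (g j)).
  by apply/matrixP => i j; rewrite !mxE.
rewrite hchar => /esym/prod_XsubC_perm[p hp].
pose B' := col_perm p B.
have colB i : col i B' = col (p i) B by apply/matrixP => a b; rewrite !mxE.
exists (fun i => comb g (col i B')).
have B'E : B' = B *m perm_mx p^-1 by rewrite /B' col_permE.
split.
- move=> c; exists (perm_mx p *m (B ^t* *m c)).
  rewrite comb_mul B'E !mulmxA -(mulmxA B) -perm_mxM mulVg perm_mx1 mulmx1 BB'.
  by rewrite mul1mx linear_comb.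
- by move=> a; exists (B' *m a); rewrite comb_mul linear_comb.
- move=> i j; rewrite ip_comb isometry_gram mulmx1 !colB.
  have /matrixP/(_ (p j) (p i)) := BB; rewrite mxE [X in _ = X -> _]mxE => hB.
  rewrite mxE; apply: etrans; last first.
    by apply: etrans hB _; rewrite (inj_eq perm_inj) eq_sym; case: eqP.
  by apply: eq_bigr => k _; rewrite !mxE.
- move=> i j; have dg k : dom S (g k) by exact: domSX.
  rewrite !(opS_comb HS) // !colB hd (inj_eq perm_inj) hp.
  by [].
Qed.

End RitzBasis.

(** * Two-sided bounds between eigenvalues and Ritz values *)

Lemma two_mul_le_sqr_add (R : realDomainType) (a b : R) : 2 * (a * b) <= a ^+ 2 + b ^+ 2.
Proof. by have := sqr_ge0 (a - b); nra. Qed.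

(** For finite [l], clearing denominators gives [mu k < (1 - 2 s) l], and
    [(1 + s) (1 - 2 s) <= 1]. *)
Lemma gap_lower_bound (R : realType) (n : nat) (le : \bar R) (lam : nat -> \bar R)
    (mu : 'I_n -> R) (s : R) (k : 'I_n) (l : \bar R) :
  0 <= s < 1 -> 0 <= mu k -> (0 <= l)%E ->
  ([set lam p | p in [set p | (n <= p)%N]] `|` [set le]) l ->
  ((s / (1 - s))%:E < mine (gap le lam mu) 1)%E ->
  (((1 + s) * mu k)%:E < l)%E.
Proof.
move=> /andP[s0 s1] mu0 l0 hl; rewrite lt_min => /andP[h1 h2].
have {}h1 : ((s / (1 - s))%:E < relative_gap l (mu k))%E.
  by apply: lt_le_trans h1 _; apply: ereal_inf_lbound; exists k => //; exists l.
case: l l0 hl h1 => [x| |]; last by [].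
- rewrite !lte_fin lee_fin /= => x0 _.
  have s1' : 0 < 1 - s by rewrite subr_gt0.
  have e0 : 0 <= s / (1 - s) by rewrite divr_ge0 // ltW.
  (* Division by zero makes the relative gap [0] here, which cannot exceed [s / (1 - s) >= 0]. *)
  have [xm|xm] := eqVneq (x + mu k) 0.
    by rewrite xm invr0 mulr0 ltNge e0.
  have xp : 0 < x + mu k by rewrite lt_def xm addr_ge0.
  rewrite ltr_pdivrMr // mulrAC ltr_pdivlMr // => h3.
  by nra.
- by rewrite ltry.
Qed.

Section Bounds.
Context {R : realType} {V : completeNormedModType R[i]}.
Context (ip : {dot V for conjC}).
Context (Hip : induces_norm ip).
Context (H S : operator V) (HS : is_sqrt_operator ip H S).
Local Notation C := R[i].
Local Notation rip := (real_ip ip).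
Local Notation sq := (sqnorm ip).
Context (lam : nat -> \bar R) (Hlam : enumerates_eigenvalues H lam).
Context (n : nat) (mu : 'I_n -> R) (x : 'I_n -> V) (s : R).
Context (mu_mono : {homo mu : i j / (i <= j)%N >-> i <= j}).
Context (xS : forall i, dom S (x i)).
Context (x_orth : forall i j, ip (x i) (x j) = if i == j then (1 : R)%:C else 0).
Context (Sx_orth :
  forall i j, ip (S (x i)) (S (x j)) = if i == j then (mu i)%:C else 0).

Lemma ritz_ge0 i : 0 <= mu i.
Proof.
have := Sx_orth i i; rewrite eqxx ip_sq => /(@complexI R) <-.
exact: sq_ge0.
Qed.

(** The trial space is the span of the Ritz vectors of index [0] to [i]. *)
Lemma lam_le_ritz (i : 'I_n) : (lam i <= (mu i)%:E)%E.
Proof.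
pose w (j : 'I_i.+1) : 'I_n := widen_ord (ltn_ord i) j.
have w_orth d (f : V -> V) :
    (forall k l, ip (f (x k)) (f (x l)) = if k == l then (d k)%:C else 0) ->
    forall k l, ip (f (x (w k))) (f (x (w l))) = if k == l then (d (w k))%:C else 0.
  by move=> h k l; rewrite h -!val_eqE.
apply: (lam_le_of_subspace HS Hlam Hip (g := fun j => x (w j))) => // c c0.
have dw j : dom S (x (w j)) by [].
have e1 : sq (comb (fun j => x (w j)) c) = \sum_j sqC (c j 0).
  rewrite (sq_comb c (w_orth (fun=> 1) id x_orth)).
  by apply: eq_bigr => j _; rewrite mul1r.
split.
  apply: contra_neq c0 => h; apply: sumsq_eq0.
  by rewrite -e1 h /sqnorm rip0l.
rewrite (opS_comb HS) // (sq_comb c (w_orth mu S Sx_orth)) e1 mulr_sumr.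
apply: ler_sum => j _; rewrite ler_wpM2r ?sqC_ge0 //; apply: mu_mono.
by rewrite /= -ltnS.
Qed.

Context (s01 : 0 <= s < 1).
Context (angle : forall c y, dom S y -> (forall j, ip (x j) y = 0) ->
  rip (S (comb x c)) (S y) <= s * (nr (S (comb x c)) * nr (S y))).

Lemma comb_orth c y : (forall j, ip (x j) y = 0) -> ip (comb x c) y = 0.
Proof. by move=> h; rewrite ip_combl big1 // => j _; rewrite h mulr0. Qed.

Lemma angle_sq c y : dom S y -> (forall j, ip (x j) y = 0) ->
  2 * rip (S (comb x c)) (S y) <= s * (sq (S (comb x c)) + sq (S y)).
Proof.
move=> dy hy; have h1 := angle c dy hy; case/andP: s01 => s0 _.
have h2 := two_mul_le_sqr_add (nr (S (comb x c))) (nr (S y)).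
rewrite !(nr_sq Hip) in h2; have h3 := ler_wpM2l s0 h2; lra.
Qed.

Lemma dom_combx c : dom S (comb x c).
Proof. exact: (domS_comb HS). Qed.

Lemma form_upper c y : dom S y -> (forall j, ip (x j) y = 0) ->
  sq (S (comb x c + y)) <= (1 + s) * (sq (S (comb x c)) + sq (S y)).
Proof.
move=> dy hy; have := angle_sq c dy hy.
rewrite (opSD HS) //; last exact: dom_combx.
rewrite {3}/sqnorm !ripE (ripC ip (S y)) -!/(sq _); lra.
Qed.

Lemma form_lower c y : dom S y -> (forall j, ip (x j) y = 0) ->
  (1 - s) * (sq (S (comb x c)) + sq (S y)) <= sq (S (comb x c + y)).
Proof.
(* Passing to [- c] reverses the cross term and keeps the diagonal blocks. *)
move=> dy hy; have := angle_sq (- c) dy hy.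
have -> : comb x (- c) = - comb x c by rewrite -scaleN1r combZ scaleN1r.
rewrite (opSN HS); last exact: dom_combx.
rewrite (opSD HS) //; last exact: dom_combx.
rewrite /sqnorm !ripE (ripC ip (S y)); lra.
Qed.

Lemma sq_combx c : sq (comb x c) = \sum_j sqC (c j 0).
Proof.
rewrite (@sq_comb _ _ ip _ _ (fun=> 1)) //.
by apply: eq_bigr => j _; rewrite mul1r.
Qed.

Lemma sq_Scombx c : sq (S (comb x c)) = \sum_j mu j * sqC (c j 0).
Proof. by rewrite (opS_comb HS) // (sq_comb c Sx_orth). Qed.

(** Otherwise [form_upper] bounds the quotient by [(1 + s) * mu k] on the span of [y] and all Ritz
    vectors, of dimension [n + 1], and min-max bounds [lam n] likewise. *)
Lemma form_off_range (k : 'I_n) y :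
  (forall j, mu j <= mu k) -> (((1 + s) * mu k)%:E < lam n)%E ->
  dom S y -> (forall j, ip (x j) y = 0) -> mu k * sq y <= sq (S y).
Proof.
move=> kmax hlam dy hy; rewrite leNgt; apply/negP => hlt.
have y0 : 0 < sq y.
  rewrite lt_def sq_ge0 andbT; apply/eqP => y0; move: hlt.
  by rewrite y0 mulr0 ltNge sq_ge0.
move: hlam; rewrite ltNge => /negP; apply.
have s1 : 0 <= 1 + s by case/andP: s01 => s0 _; rewrite addr_ge0.
(* [y] comes first because [1 + n] is convertible to [n.+1]. *)
apply: (lam_le_of_subspace HS Hlam Hip (g := join_fam (fun _ : 'I_1 => y) x)).
  by move=> j; rewrite /join_fam; case: fintype.split.
move=> c c0; rewrite (comb_join (m := 1) (n := n)).
set a := usubmx _; set b := dsubmx _.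
have -> : comb (fun=> y) a = a 0 0 *: y by rewrite /comb big_ord1.
rewrite addrC; set z := a 0 0 *: y.
have dz : dom S z by exact: (domSZ HS).
have hz j : ip (x j) z = 0 by rewrite linearZr_LR /= hy mulr0.
have squ : sq (comb x b + z) = sq (comb x b) + sq z.
  by apply: pythagoras; rewrite /real_ip (comb_orth b hz).
split.
  rewrite -(sq_eq0 ip) squ; apply/eqP => h0.
  have := sq_ge0 ip (comb x b); have := sq_ge0 ip z => p1 p2.
  have b0 : b = 0 by apply: sumsq_eq0; rewrite -sq_combx; lra.
  have z0 : sqC (a 0 0) * sq y = 0 by rewrite -sqZ -/z; lra.
  have a0 : a = 0.
    apply/matrixP => i j; rewrite !ord1 [RHS]mxE; apply: sqC_eq0.
    by move/eqP: z0; rewrite mulf_eq0 (gt_eqF y0) orbF => /eqP.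
  move/eqP: c0; apply; have := @vsubmxK _ 1 n _ c.
  by rewrite -/a -/b a0 b0 col_mx0.
apply: le_trans (form_upper b dz hz) _; rewrite -mulrA ler_wpM2l // squ mulrDr.
apply: lerD.
  rewrite sq_Scombx sq_combx mulr_sumr; apply: ler_sum => j _.
  by rewrite ler_wpM2r ?sqC_ge0.
by rewrite /z (opSZ HS) // !sqZ mulrCA ler_wpM2l ?sqC_ge0 // ltW.
Qed.

(** Some nonzero [u] in the span of the first [i + 1] eigenvectors is orthogonal to the first [i]
    Ritz vectors. Its component in the Ritz span involves only values from [mu i] on, the rest obeys
    [form_off_range], and [form_lower] combines them into
    [(1 - s) mu_i |u|^2 <= |S u|^2 <= t |u|^2]. *)
Lemma lam_ge_ritz (i k : 'I_n) (t : R) :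
  (forall j, mu j <= mu k) -> (((1 + s) * mu k)%:E < lam n)%E ->
  lam i = t%:E -> (t%:E < lambda_ess H)%E -> (1 - s) * mu i <= t.
Proof.
move=> kmax hlam hi tess.
have [e [e1 e2 _]] := eigenbasis HS Hlam; have [lamS lam0 _] := Hlam.
pose f (j : 'I_i.+1) := e j.
have hj (j : 'I_i.+1) : exists2 d : R, lam j = d%:E & d <= t.
  have ji : (lam j <= t%:E)%E by rewrite -hi; apply: lamS; rewrite -ltnS.
  have /andP[j0 _] := lam0 j.
  case: (lam j) ji j0 => [d| |//]; last by rewrite leye_eq.
  by rewrite lee_fin => dt _; exists d.
have /choice[d hd] : forall j : 'I_i.+1, exists d : R, lam j = d%:E /\ d <= t.
  by move=> j; have [d] := hj j; exists d.
have dess j : ((d j)%:E < lambda_ess H)%E.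
  by apply: le_lt_trans tess; rewrite lee_fin; case: (hd j).
have fe j : opeigenspace H (d j)%:C (f j).
  by apply: e1 => //; case: (hd j).
have f_orth j l : ip (f j) (f l) = if j == l then (1 : R)%:C else 0.
  by rewrite e2 //; [rewrite -val_eqE; case: eqVneq|have [-> _] := hd j|
    have [-> _] := hd l].
have fS j : dom S (f j) by case: (fe j) => /(domHS HS).
have Sf_orth j l : ip (S (f j)) (S (f l)) = if j == l then (d j)%:C else 0.
  have [dj Hj] := fe j; rewrite -(H_form_ip HS) // Hj linearZl_LR /= f_orth.
  by case: eqP; rewrite ?mulr1 ?mulr0.
have [c c0 hc] :=
  exists_orthogonal_comb ip f (fun j : 'I_i => x (widen_ord (ltnW (ltn_ord i)) j)) (leqnn _).
pose u := comb f c.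
have squ : sq u = \sum_j sqC (c j 0).
  rewrite (@sq_comb _ _ ip _ _ (fun=> 1)) //.
  by apply: eq_bigr => j _; rewrite mul1r.
have u0 : 0 < sq u.
  rewrite lt_def sq_ge0 andbT; apply: contra_neq c0 => h; apply: sumsq_eq0.
  by rewrite -squ.
have Su : sq (S u) <= t * sq u.
  rewrite (opS_comb HS) // (sq_comb c Sf_orth) squ mulr_sumr.
  by apply: ler_sum => j _; rewrite ler_wpM2r ?sqC_ge0 //; case: (hd j).
pose a := \col_j ip u (x j); pose y := u - comb x a.
have uE : u = comb x a + y by rewrite /y addrC subrK.
have hy j : ip (x j) y = 0.
  apply: ip0C; rewrite /y linearBl /= ip_combl (bigD1 j) //= big1 ?addr0.
    by rewrite x_orth eqxx mxE mulr1 subrr.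
  by move=> l lj; rewrite x_orth (negPf lj) mulr0.
have dy : dom S y.
  by apply: (domSD HS); [exact: (domS_comb HS)|exact/(domSN HS)/dom_combx].
have mk : mu i * sq y <= sq (S y).
  apply: le_trans (form_off_range kmax hlam dy hy).
  by rewrite ler_wpM2r ?sq_ge0.
have mx : mu i * sq (comb x a) <= sq (S (comb x a)).
  rewrite sq_Scombx sq_combx mulr_sumr; apply: ler_sum => j _.
  have [ij|ji] := leqP i j; first by rewrite ler_wpM2r ?sqC_ge0 // mu_mono.
  have -> : a j 0 = 0.
    rewrite mxE -(hc (Ordinal ji)); congr (ip _ (x _)); exact: val_inj.
  by rewrite /sqC mul0r /= !mulr0.
have sqs : sq u = sq (comb x a) + sq y.
  by rewrite uE; apply: pythagoras; rewrite /real_ip comb_orth.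
have lo := form_lower a dy hy; rewrite -uE in lo.
case/andP: s01 => _ s1.
rewrite -(ler_pM2r u0); apply: le_trans Su; apply: le_trans lo.
rewrite -mulrA ler_wpM2l ?subr_ge0 ?(ltW s1) // sqs mulrDr; exact: lerD.
Qed.

End Bounds.

Theorem theorem5p1 (R : realType) (V : completeNormedModType R[i])
    (ip : {dot V for conjC}) (h : qform V) (H S : operator V) (n r : nat)
    (X : {linear 'cV[R[i]]_n -> V}) (mu : 'I_n -> R) (lam : nat -> \bar R) :
  let sinT := sin (max_principal_angle ip (S @` range X) (inv_image S (range X))) in
  let gamma := gap (lambda_ess H) lam mu in
  let eta := sinT / (1 - sinT) in
  induces_norm ip ->
  nonneg_definite ip h H S ->
  isometry_from_Cn X ->
  range X `<=` qdom h ->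
  has_dim (opkernel H) r -> (r <= n)%N ->
  ordered_eigenvalues (adjoint_mul ip (fun c => S (X c))) mu ->
  enumerates_eigenvalues H lam ->
  sinT < 1 ->
  (0 <= gamma)%E ->
  (eta%:E < mine gamma 1)%E ->
  forall i : 'I_n,
    (lam i < lambda_ess H)%E /\
    (`|lam i - (mu i)%:E| <= (mu i * sinT)%:E)%E.
Proof.
move=> sinT gamma eta Hip [_ [_ HS domSh _] ess0] Xiso XS0 kerH _ Hmu Hlam s1 _ heta i.
have XS : range X `<=` dom S by rewrite domSh.
have s01 : 0 <= sinT < 1 by rewrite s1 (sin_angle_ge0 Hip).
have [x [Xx xX x_orth Sx_orth]] := ritz_basis Hip HS Xiso XS Hmu.
have [mu_mono _] := Hmu; have [_ lam0 _] := Hlam.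
have xS j : dom S (x j).
  have [c hc] := xX (delta_mx j 0); rewrite comb_delta in hc.
  by rewrite hc; exact: domSX.
have angle c y : dom S y -> (forall j, ip (x j) y = 0) ->
    real_ip ip (S (comb x c)) (S y) <= sinT * (nr (S (comb x c)) * nr (S y)).
  move=> dy hy; have [a ->] := xX c.
  apply: (form_angle Hip HS Xiso XS kerH ess0) => // b.
  by have [d ->] := Xx b; exact: comb_orth.
(* The index [i] shows that [n] is positive, so there is a last index, carrying the largest Ritz
   value. *)
have k_lt : (n.-1 < n)%N by rewrite prednK // (leq_trans _ (ltn_ord i)).
pose k := Ordinal k_lt.
have kmax j : mu j <= mu k by apply: mu_mono; rewrite /= -ltnS prednK // (leq_trans _ k_lt).
have mu0 j := ritz_ge0 Sx_orth j.
have lamn : (((1 + sinT) * mu k)%:E < lam n)%E.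
  apply: gap_lower_bound heta => //; first by case/andP: (lam0 n).
  by left; exists n => /=.
(* The index infinity of the gap places the largest Ritz value, and with it [lam i <= mu i], below
   the essential spectrum. *)
have less : (((1 + sinT) * mu k)%:E < lambda_ess H)%E.
  by apply: gap_lower_bound heta => //; [exact: ltW|right].
have upper := lam_le_ritz Hip HS Hlam mu_mono xS x_orth Sx_orth i.
have iess : (lam i < lambda_ess H)%E.
  apply: le_lt_trans upper (le_lt_trans _ less); rewrite lee_fin.
  case/andP: s01 => s0 _; apply: le_trans (kmax i) _.
  by rewrite ler_peMl // lerDl.
split => //.
have /andP[i0 _] := lam0 i.
have [t ti] : exists t : R, lam i = t%:E.
  by case: (lam i) upper i0 => [t| |//] => [_ _|]; [exists t|rewrite leye_eq].
have lower := lam_ge_ritz Hip HS Hlam mu_mono xS x_orth Sx_orth s01 angle kmax lamn ti.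
rewrite ti in iess upper *; rewrite lee_fin in upper.
have {}lower := lower iess.
rewrite -EFinB abse_EFin lee_fin ler_norml; apply/andP; split; nra.
Qed.
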